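(* Let $M$ be a contact $CR$-submanifold of a Sasakian statistical manifold $(\bar M,\bar\nabla,\bar g,\phi,\xi)$, with invariant distribution $D$ and anti-invariant distribution $D^\perp$. Then $D$ is integrable if and only if \[ \bar g(h(X,\phi Y),\phi Z)=\bar g(h(Y,\phi X),\phi Z) \] for all $X,Y\in\Gamma(D)$ and $Z\in\Gamma(D^\perp)$.
   Context: A statistical manifold $(\bar M,\bar\nabla,\bar g)$ is a smooth Riemannian manifold $(\bar M,\bar g)$ with a torsion-free affine connection $\bar\nabla$ such that $(\bar\nabla_X\bar g)(Y,Z)=(\bar\nabla_Y\bar g)(X,Z)$. The dual connection $\bar\nabla^*$ is defined by $X\bar g(Y,Z)=\bar g(\bar\nabla_XY,Z)+\bar g(Y,\bar\nabla^*_XZ)$. Let $\hat{\bar\nabla}$ be the Levi-Civita connection of $\bar g$ and $K(X,Y)=\bar\nabla_XY-\hat{\bar\nabla}_XY$. An almost contact metric structure on an odd-dimensional $(\bar M,\bar g)$ consists of a $(1,1)$-tensor $\phi$, a unit vector field $\xi$ and a 1-form $\eta$ with $\phi^2X=-X+\eta(X)\xi$, $\bar g(X,\xi)=\eta(X)$, $\bar g(\phi X,\phi Y)=\bar g(X,Y)-\eta(X)\eta(Y)$ (so $\phi\xi=0$, $\eta\circ\phi=0$, $\bar g(\phi X,Y)=-\bar g(X,\phi Y)$). A Sasakian statistical manifold $(\bar M,\bar\nabla,\bar g,\phi,\xi)$ is a statistical manifold with an almost contact metric structure such that $\hat{\bar\nabla}_X\xi=\phi X$, $(\hat{\bar\nabla}_X\phi)Y=\bar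 g(Y,\xi)X-\bar g(Y,X)\xi$ and $K(X,\phi Y)+\phi K(X,Y)=0$. Consequently $\bar\nabla_X\phi Y-\phi\bar\nabla^*_XY=\bar g(Y,\xi)X-\bar g(Y,X)\xi$ and $\bar\nabla_X\xi=\phi X+\bar g(\bar\nabla_X\xi,\xi)\xi$, and the same identities hold with $\bar\nabla$ and $\bar\nabla^*$ interchanged. For a submanifold $M$ and $X,Y\in\Gamma(TM)$, split into tangential and normal parts: $\bar\nabla_XY=\nabla_XY+h(X,Y)$, $\bar\nabla^*_XY=\nabla^*_XY+h^*(X,Y)$. $M$ is a contact $CR$-submanifold if $TM=D\oplus D^\perp$ for a differentiable distribution $D$ with $\xi\in\Gamma(D)$, $\phi(D_x)\subseteq D_x$, and with orthogonal complement $D^\perp$ satisfying $\phi(D^\perp_x)\subseteq T^\perp_xM$ for all $x\in M$. *)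

(* Defs.v *)
From mathcomp Require Import all_boot all_order all_algebra.
From mathcomp Require Import all_classical all_reals all_analysis.

Set Implicit Arguments.
Unset Strict Implicit.
Unset Printing Implicit Defensive.

Import Order.TTheory GRing.Theory Num.Theory.
Import numFieldNormedType.Exports.

Local Open Scope classical_set_scope.
Local Open Scope ring_scope.

Section Smooth.
Context {R : realType} {V W : normedModType R}.

(* Only meant for open [U]. *)
Fixpoint Ck (k : nat) (f : V -> W) (U : set V) : Prop :=
  if k is k'.+1 then
    (forall x, U x -> differentiable f x) /\
    (forall v, Ck k' (fun x => 'D_v f x) U)
  else forall x, U x -> {for x, continuous f}.

Definition smooth_on (f : V -> W) (U : set V) : Prop := forall k, Ck k f U.

End Smooth.

(* A manifold carries a (not necessarily maximal) smooth atlas.  The choice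
   [chart_at] of a chart around each point identifies T_p M with R^n: a vector
   of T_p M is represented by its components in the chart [chart_at p]. *)
Record manifold (R : realType) (n : nat) := Manifold {
  carrier :> topologicalType ;
  atlas : Type ;
  dom : atlas -> set carrier ;
  chart : atlas -> carrier -> 'rV[R]_n ;
  chart_inv : atlas -> 'rV[R]_n -> carrier ;
  chart_at : carrier -> atlas ;
  hausdorff_carrier : hausdorff_space carrier ;
  second_countable_carrier : @second_countable carrier ;
  dom_open : forall a, open (dom a) ;
  codom_open : forall a, open (chart a @` dom a) ;
  chartK : forall a p, dom a p -> chart_inv a (chart a p) = p ;
  chart_continuous : forall a p, dom a p -> {for p, continuous (chart a)} ;
  chart_inv_continuous : forall a x, (chart a @` dom a) x ->
    {for x, continuous (chart_inv a)} ;
  transition_smooth : forall a b,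
    smooth_on (chart b \o chart_inv a) (chart a @` (dom a `&` dom b)) ;
  dom_chart_at : forall p, dom (chart_at p) p
}.

Arguments dom {R n m} : rename.
Arguments chart {R n m} : rename.
Arguments chart_inv {R n m} : rename.
Arguments chart_at {R n m} : rename.

Section Calculus.
Context {R : realType} {n : nat} (M : manifold R n).

Definition smooth_fun {W : normedModType R} (F : M -> W) (U : set M) : Prop :=
  forall a : atlas M,
    smooth_on (F \o chart_inv a) (chart a @` (dom a `&` U)).

(* The derivative of [F] at [p] along [v] in T_p M. *)
Definition deriv {W : normedModType R} (F : M -> W) (p : M) (v : 'rV[R]_n) : W :=
  'D_v (F \o chart_inv (chart_at p)) (chart (chart_at p) p).

(* The components in the chart [a] of [v] in T_p M. *)
Definition tcoord (a : atlas M) (p : M) (v : 'rV[R]_n) : 'rV[R]_n :=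
  deriv (chart a) p v.

(* The vector field on [dom a] whose components in [a] are constantly [v]. *)
Definition coord_field (a : atlas M) (v : 'rV[R]_n) (q : M) : 'rV[R]_n :=
  'D_v (chart (chart_at q) \o chart_inv a) (chart a q).

(* [X p] is read in T_p M, i.e., in the chart [chart_at p]. *)
Definition vfield := M -> 'rV[R]_n.

Definition smooth_vf (X : vfield) (U : set M) : Prop :=
  forall a : atlas M, smooth_fun (fun p => tcoord a p (X p)) (dom a `&` U).

(* [X, Y]^k = X^i d_i Y^k - Y^i d_i X^k in the chart around [p]. *)
Definition lie (X Y : vfield) : vfield := fun p =>
  let a := chart_at p in
  deriv (fun q => tcoord a q (Y q)) p (X p) -
  deriv (fun q => tcoord a q (X q)) p (Y p).

End Calculus.

Arguments vfield {R n}.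

Section Geometry.
Context {R : realType} {n : nat} (M : manifold R n).

(* Tensors and connections are described by their action on smooth vector
   fields over arbitrary open sets. *)

Record riemannian_metric (g : M -> 'rV[R]_n -> 'rV[R]_n -> R) : Prop :=
  RiemannianMetric {
  metric_linear : forall p w, scalar (fun v => g p v w) ;
  metric_sym : forall p v w, g p v w = g p w v ;
  metric_pos : forall p v, v != 0 -> 0 < g p v v ;
  metric_smooth : forall U, open U -> forall X Y : vfield M,
    smooth_vf X U -> smooth_vf Y U ->
    smooth_fun (fun p => g p (X p) (Y p) : R^o) U
}.

Record affine_connection (nabla : vfield M -> vfield M -> vfield M) : Prop :=
  AffineConnection {
  conn_local : forall U, open U -> forall X X' Y Y' : vfield M,
    smooth_vf X U -> smooth_vf X' U -> smooth_vf Y U -> smooth_vf Y' U ->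
    (forall p, U p -> X p = X' p) -> (forall p, U p -> Y p = Y' p) ->
    forall p, U p -> nabla X Y p = nabla X' Y' p ;
  conn_smooth : forall U, open U -> forall X Y : vfield M,
    smooth_vf X U -> smooth_vf Y U -> smooth_vf (nabla X Y) U ;
  conn_linear : forall U, open U -> forall (f : M -> R^o) (X X' Y : vfield M),
    smooth_fun f U -> smooth_vf X U -> smooth_vf X' U -> smooth_vf Y U ->
    forall p, U p ->
      nabla (fun q => (f q : R) *: X q + X' q) Y p =
      (f p : R) *: nabla X Y p + nabla X' Y p ;
  conn_additive : forall U, open U -> forall X Y Y' : vfield M,
    smooth_vf X U -> smooth_vf Y U -> smooth_vf Y' U ->
    forall p, U p ->
      nabla X (fun q => Y q + Y' q) p = nabla X Y p + nabla X Y' p ;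
  conn_leibniz : forall U, open U -> forall (f : M -> R^o) (X Y : vfield M),
    smooth_fun f U -> smooth_vf X U -> smooth_vf Y U ->
    forall p, U p ->
      nabla X (fun q => (f q : R) *: Y q) p =
      (f p : R) *: nabla X Y p + (deriv f p (X p) : R) *: Y p
}.

Definition torsion_free (nabla : vfield M -> vfield M -> vfield M) : Prop :=
  forall U, open U -> forall X Y : vfield M,
    smooth_vf X U -> smooth_vf Y U ->
    forall p, U p -> nabla X Y p - nabla Y X p = lie X Y p.

(* (nabla_X g)(Y, Z) *)
Definition cov_metric (nabla : vfield M -> vfield M -> vfield M)
    (g : M -> 'rV[R]_n -> 'rV[R]_n -> R) (X Y Z : vfield M) (p : M) : R :=
  (deriv (fun q => g q (Y q) (Z q) : R^o) p (X p) : R)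
  - g p (nabla X Y p) (Z p) - g p (Y p) (nabla X Z p).

Record levi_civita (g : M -> 'rV[R]_n -> 'rV[R]_n -> R)
    (lc : vfield M -> vfield M -> vfield M) : Prop := LeviCivita {
  lc_connection : affine_connection lc ;
  lc_torsion_free : torsion_free lc ;
  lc_metric : forall U, open U -> forall X Y Z : vfield M,
    smooth_vf X U -> smooth_vf Y U -> smooth_vf Z U ->
    forall p, U p -> cov_metric lc g X Y Z p = 0
}.

Record statistical (nabla : vfield M -> vfield M -> vfield M)
    (g : M -> 'rV[R]_n -> 'rV[R]_n -> R) : Prop := Statistical {
  stat_metric : riemannian_metric g ;
  stat_connection : affine_connection nabla ;
  stat_torsion_free : torsion_free nabla ;
  stat_codazzi : forall U, open U -> forall X Y Z : vfield M,
    smooth_vf X U -> smooth_vf Y U -> smooth_vf Z U ->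
    forall p, U p ->
      cov_metric nabla g X Y Z p = cov_metric nabla g Y X Z p
}.

Record almost_contact_metric (g : M -> 'rV[R]_n -> 'rV[R]_n -> R)
    (phi : M -> {linear 'rV[R]_n -> 'rV[R]_n}) (xi : vfield M)
    (eta : M -> {scalar 'rV[R]_n}) : Prop := AlmostContactMetric {
  acm_odd : odd n ;
  phi_smooth : forall U, open U -> forall X : vfield M,
    smooth_vf X U -> smooth_vf (fun p => phi p (X p)) U ;
  xi_smooth : smooth_vf xi setT ;
  xi_unit : forall p, g p (xi p) (xi p) = 1 ;
  eta_smooth : forall U, open U -> forall X : vfield M,
    smooth_vf X U -> smooth_fun (fun p => eta p (X p) : R^o) U ;
  phi_sqr : forall p v, phi p (phi p v) = - v + eta p v *: xi p ;
  metric_xi : forall p v, g p v (xi p) = eta p v ;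
  metric_phi : forall p v w,
    g p (phi p v) (phi p w) = g p v w - eta p v * eta p w
}.

(* [lc], the Levi-Civita connection, is determined by [metric]; it is stored as
   data rather than built from the Koszul formula. *)
Record sasakian_statistical := SasakianStatistical {
  metric : M -> 'rV[R]_n -> 'rV[R]_n -> R ;
  nabla : vfield M -> vfield M -> vfield M ;
  lc : vfield M -> vfield M -> vfield M ;
  phi : M -> {linear 'rV[R]_n -> 'rV[R]_n} ;
  xi : vfield M ;
  eta : M -> {scalar 'rV[R]_n} ;
  ss_statistical : statistical nabla metric ;
  ss_levi_civita : levi_civita metric lc ;
  ss_contact : almost_contact_metric metric phi xi eta ;
  ss_lc_xi : forall U, open U -> forall X : vfield M, smooth_vf X U ->
    forall p, U p -> lc X xi p = phi p (X p) ;
  ss_lc_phi : forall U, open U -> forall X Y : vfield M,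
    smooth_vf X U -> smooth_vf Y U ->
    forall p, U p ->
      lc X (fun q => phi q (Y q)) p - phi p (lc X Y p) =
      metric p (Y p) (xi p) *: X p - metric p (Y p) (X p) *: xi p ;
  ss_K_phi : forall U, open U -> forall X Y : vfield M,
    smooth_vf X U -> smooth_vf Y U ->
    let K (A B : vfield M) : vfield M := fun p => nabla A B p - lc A B p in
    forall p, U p -> K X (fun q => phi q (Y q)) p + phi p (K X Y p) = 0
}.

(* Sections are global, with the fibre at each point given by a predicate. *)
Definition section (E : M -> set 'rV[R]_n) (X : vfield M) : Prop :=
  smooth_vf X setT /\ forall p, E p (X p).

Definition distribution (r : nat) (D : M -> {vspace 'rV[R]_n}) : Prop :=
  forall p, exists U, [/\ open U, U p &
    exists X : 'I_r -> vfield M,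
      (forall i, smooth_vf (X i) U) /\
      forall q, U q -> basis_of (D q) [seq X i q | i <- enum 'I_r]].

Definition fibre (D : M -> {vspace 'rV[R]_n}) (p : M) : set 'rV[R]_n :=
  [set v | v \in D p].

(* A distribution is integrable when its sections are closed under the Lie
   bracket. *)
Definition integrable_distribution (D : M -> {vspace 'rV[R]_n}) : Prop :=
  forall X Y, section (fibre D) X -> section (fibre D) Y ->
    section (fibre D) (lie X Y).

End Geometry.

Section Submanifold.
Context {R : realType} {m n : nat} {M : manifold R m} {N : manifold R n}.
Variable iota : M -> N.

Definition smooth_map : Prop :=
  continuous iota /\
  forall b : atlas N, smooth_fun (chart b \o iota) (iota @^-1` dom b).

(* The differential of [iota] at [p], from T_p M to T_(iota p) N. *)
Definition push (p : M) (v : 'rV[R]_m) : 'rV[R]_n :=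
  deriv (chart (chart_at (iota p)) \o iota) p v.

Definition immersion : Prop := smooth_map /\ forall p, injective (push p).

(* A vector field along [iota]: [V p] is read in T_(iota p) N. *)
Definition vfield_along := M -> 'rV[R]_n.

Definition push_vf (X : vfield M) : vfield_along := fun p => push p (X p).

(* nabla_X V for [V] along [iota]: if V = V^j (E_j o iota) in the coordinate
   frame of the chart around [iota p], this is
   X(V^j) E_j + V^j nabla_(d iota X) E_j. *)
Definition cov_along (nabla : vfield N -> vfield N -> vfield N)
    (X : vfield M) (V : vfield_along) : vfield_along := fun p =>
  let a := chart_at (iota p) in
  let comp := fun q => tcoord a (iota q) (V q) in
  deriv comp p (X p) +
  \sum_(j < n) comp p 0 j *:
    nabla (coord_field a (push p (X p))) (coord_field a (delta_mx 0 j)) (iota p).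

Variable S : sasakian_statistical N.

Definition is_normal (p : M) (w : 'rV[R]_n) : Prop :=
  forall v, metric S (iota p) w (push p v) = 0.

(* The vector of T_p M whose image is the tangential part of [w]. *)
Definition tangential (p : M) (w : 'rV[R]_n) : 'rV[R]_m :=
  xget 0 [set v | is_normal p (w - push p v)].

Definition normal_part (p : M) (w : 'rV[R]_n) : 'rV[R]_n :=
  w - push p (tangential p w).

(* h(X, Y), where the second argument is a tangent field given as a field
   along [iota]. *)
Definition second_ff (X : vfield M) (Y : vfield_along) : vfield_along :=
  fun p => normal_part p (cov_along (nabla S) X Y p).

Definition phi_along (V : vfield_along) : vfield_along :=
  fun p => phi S (iota p) (V p).

(* The orthogonal complement of [D p] in T_p M for the induced metric. *)
Definition orthogonal_fibre (D : M -> {vspace 'rV[R]_m}) (p : M) :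
    set 'rV[R]_m :=
  [set z | forall v, v \in D p -> metric S (iota p) (push p z) (push p v) = 0].

Record contact_CR (r : nat) (D : M -> {vspace 'rV[R]_m}) : Prop := ContactCR {
  cr_immersion : immersion ;
  cr_distribution : distribution r D ;
  cr_xi : forall p, exists2 v, v \in D p & push p v = xi S (iota p) ;
  cr_invariant : forall p v, v \in D p ->
    exists2 w, w \in D p & push p w = phi S (iota p) (push p v) ;
  cr_anti_invariant : forall p z, orthogonal_fibre D p z ->
    is_normal p (phi S (iota p) (push p z))
}.

End Submanifold.

(* Main.v *)
From mathcomp Require Import all_boot all_order all_algebra.
From mathcomp Require Import all_classical all_reals all_analysis.
Require Import Defs.

(** For [Z] in [D^perp] the vector [phi Z] is normal, so pairing a second
    fundamental form with [phi Z] is the same as pairing the whole ambient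
    derivative with it: [g (h(X, phi Y), phi Z) = g (nabla_X (phi Y), phi Z)].
    The Sasakian identities, combined with [K(X, phi Y) + phi K(X, Y) = 0], give
    [nabla_X (phi Y) = phi (nabla*_X Y) + g(Y, xi) X - g(Y, X) xi] where
    [nabla* = lc - K] ([nabla_phi]).  The connection [nabla*] is torsion free and
    the last term is symmetric in [X] and [Y], so
      [nabla_X (phi Y) - nabla_Y (phi X)
         = phi [X, Y] + g(Y, xi) X - g(X, xi) Y]
    along the submanifold ([cov_along_phi_commutator]).  Paired with [phi Z],
    the two tangent terms vanish; since [xi] lies in [D], [eta Z = 0], and
    compatibility of [g] with [phi] leaves
      [g (h(X, phi Y), phi Z) - g (h(Y, phi X), phi Z) = g ([X, Y], Z)]
    ([metric_second_ff_sub]).  Hence the condition says exactly that [[X, Y]] is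
    orthogonal to every section of [D^perp].  If [D] is integrable this is clear.
    Conversely it is enough to test with one section [Z], the component of
    [[X, Y]] in [D^perp]: then [g (Z, Z) = g ([X, Y], Z) = 0], so [Z = 0] and
    [[X, Y]] lies in [D].  This section is smooth because in a local frame of [D]
    it is computed with the inverse of the Gram matrix
    ([smooth_orthogonal_part]).

    Tangent vectors are given by components in a chart that may depend
    discontinuously on the base point, so everything that concerns fields is
    reduced to derivatives of scalar functions, for which the chart does not
    matter.  In particular [[X, Y]] is handled as a commutator of derivations
    ([deriv_lie]); this yields both its smoothness and its compatibility with
    the immersion, and it rests on the symmetry of second derivatives
    ([derive_symmetric]). *)

Set Implicit Arguments.
Unset Strict Implicit.
Unset Printing Implicit Defensive.
Import Order.TTheory GRing.Theory Num.Theory.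
Import numFieldNormedType.Exports.
Local Open Scope classical_set_scope.
Local Open Scope ring_scope.

(** * Functions of class C^k between normed spaces *)

Section CkGeneral.
Context {R : realType} {V W : normedModType R}.
Implicit Types (f g : V -> W) (U : set V) (k : nat).

Lemma Ck_continuous k f U x : Ck k f U -> U x -> {for x, continuous f}.
Proof.
case: k => [|k] /= Hf Ux; first exact: Hf.
exact/differentiable_continuous/Hf.1.
Qed.

Lemma CkW k f U : Ck k.+1 f U -> Ck k f U.
Proof.
elim: k f => [|k IH] f Hf; first by move=> x Ux; exact: Ck_continuous Hf Ux.
by split=> [|v]; [exact: Hf.1|apply/IH/Hf.2].
Qed.

(** The class C^k is tested pointwise, so a cover of [U] by arbitrary sets,
    not only open ones, is enough. *)
Lemma Ck_local k f U :
  (forall x, U x -> exists2 A : set V, A x & Ck k f A) -> Ck k f U.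
Proof.
elim: k f => [|k IH] f Hf /=.
  by move=> x Ux; have [A Ax fA] := Hf _ Ux; exact: fA.
split=> [x Ux|v]; first by have [A Ax [dfA _]] := Hf _ Ux; exact: dfA.
by apply: IH => x /Hf[A Ax [_ fA]]; exists A => //; exact: fA.
Qed.

Lemma Ck_sub k f (A U : set V) : A `<=` U -> Ck k f U -> Ck k f A.
Proof. by move=> AU fU; apply: Ck_local => x /AU Ux; exists U. Qed.

Lemma near_open U (P : V -> Prop) x :
  open U -> U x -> (forall y, U y -> P y) -> \forall y \near x, P y.
Proof.
move=> Uo Ux H; apply: (filterS H); exact: open_nbhs_nbhs.
Qed.

Lemma near_eq_differentiable f g x :
  (\forall y \near x, f y = g y) -> differentiable f x -> differentiable g x.
Proof.
move=> fg df; have fgx := nbhs_singleton fg.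
have [dfc /eqaddoP dfE] := (diff_locallyP _ _).1 df.
have gE : g \o shift x = cst (g x) + 'd f x +o_ 0 id.
  apply/eqaddoP => e e0; have := dfE e e0; rewrite !nearE => He.
  near=> h.
  rewrite (_ : _ h = (f \o shift x - (cst (f x) + 'd f x)) h); first by near: h.
  rewrite /GRing.add /= /GRing.opp /= /cst /= -fgx.
  congr (_ - _); apply/esym.
  near: h; move: fg; rewrite (near_shift 0 x) subr0; exact.
by apply/diff_locallyP; rewrite (diff_unique dfc gE).
Unshelve. all: by end_near. Qed.

(** The derivatives at [x] see [f] on a neighbourhood of [x]; this is why
    agreement is asked on an open set. *)
Lemma Ck_eq k f g U : open U -> (forall x, U x -> f x = g x) ->
  Ck k f U -> Ck k g U.
Proof.
move=> Uo; elim: k f g => [|k IH] f g fg /= Hf.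
  move=> x Ux; suff : g @ x --> g x by []; rewrite -(fg _ Ux).
  apply: cvg_trans (Hf _ Ux); apply: near_eq_cvg.
  exact: near_open Uo Ux fg.
split=> [x Ux|v].
  by apply: near_eq_differentiable (Hf.1 _ Ux); exact: near_open Uo Ux fg.
apply: IH (Hf.2 v) => x Ux; apply: near_eq_derive.
exact: near_open Uo Ux fg.
Qed.

Lemma CkD k f g U : open U -> Ck k f U -> Ck k g U -> Ck k (fun x => f x + g x) U.
Proof.
move=> Uo; elim: k f g => [|k IH] f g /= Hf Hg.
  by move=> x Ux; apply: continuousD; [exact: Hf|exact: Hg].
split=> [x Ux|v]; first exact: differentiableD (Hf.1 x Ux) (Hg.1 x Ux).
apply: Ck_eq (IH _ _ (Hf.2 v) (Hg.2 v)) => // x Ux.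
by rewrite -deriveD//; apply: diff_derivable; [exact: Hf.1|exact: Hg.1].
Qed.

Lemma Ck_cst k (c : W) U : Ck k (fun=> c) U.
Proof.
elim: k c => [|k IH] c /=; first by move=> x _; exact: cst_continuous.
split=> [x _|v]; first exact: differentiable_cst.
have -> : (fun x : V => 'D_v (fun=> c) x) = fun=> 0.
  by apply/funext => x; exact: derive_cst.
exact: IH.
Qed.

Lemma Ck_sum k (I : Type) (s : seq I) (F : I -> V -> W) U : open U ->
  (forall i, Ck k (F i) U) -> Ck k (fun x => \sum_(i <- s) F i x) U.
Proof.
move=> Uo HF; elim: s => [|i s IH].
  by under eq_fun do rewrite big_nil; exact: Ck_cst.
by under eq_fun do rewrite big_cons; exact: CkD.
Qed.

End CkGeneral.

Section CkScalar.
Context {R : realType} {V : normedModType R}.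
Implicit Types (f g : V -> R^o) (U : set V) (k : nat).

Lemma CkM k f g U : open U -> Ck k f U -> Ck k g U ->
  Ck k (fun x => f x * g x : R^o) U.
Proof.
move=> Uo; elim: k f g => [|k IH] f g.
  by move=> /= Hf Hg x Ux; apply: continuousM; [exact: Hf|exact: Hg].
move=> Hf Hg; split=> [x Ux|v].
  exact: differentiableM (Hf.1 x Ux) (Hg.1 x Ux).
apply: (@Ck_eq _ _ _ _ (fun x => f x * 'D_v g x + g x * 'D_v f x)) => //.
  move=> x Ux; rewrite -[RHS]/('D_v (f * g) x) deriveM//.
    exact/diff_derivable/Hf.1.
  exact/diff_derivable/Hg.1.
apply: CkD => //; apply: IH; do ?[exact: CkW|exact: Hf.2|exact: Hg.2].
Qed.

Lemma CkV k f U : open U -> (forall x, U x -> f x != 0) -> Ck k f U ->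
  Ck k (fun x => (f x)^-1 : R^o) U.
Proof.
move=> Uo f0; elim: k => [|k IH].
  by move=> /= Hf x Ux; apply: continuousV; [exact: f0|exact: Hf].
move=> Hf; split=> [x Ux|v].
  exact: differentiableV (Hf.1 x Ux) (f0 x Ux).
apply: (@Ck_eq _ _ _ _ (fun x => (-1) * ((f x)^-1 * (f x)^-1) * 'D_v f x)) => //.
  move=> x Ux; rewrite (deriveV (f0 x Ux)); last exact/diff_derivable/Hf.1.
  by rewrite mulN1r -invfM -expr2.
apply: CkM => //; last exact: Hf.2.
by apply: CkM => //; [exact: Ck_cst|apply: CkM => //; exact/IH/CkW].
Qed.

Lemma Ck_prod k (I : Type) (s : seq I) (F : I -> V -> R^o) U : open U ->
  (forall i, Ck k (F i) U) -> Ck k (fun x => \prod_(i <- s) F i x : R^o) U.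
Proof.
move=> Uo HF; elim: s => [|i s IH].
  by under eq_fun do rewrite big_nil; exact: Ck_cst.
by under eq_fun do rewrite big_cons; exact: CkM.
Qed.

End CkScalar.

Section CkRow.
Context {R : realType} {V : normedModType R} {n : nat}.
Implicit Types (F : V -> 'rV[R]_n) (U : set V) (k : nat).

Lemma differentiable_rowP F x :
  differentiable F x <-> forall j, differentiable (fun y => F y 0 j : R^o) x.
Proof.
split=> [dF j|dF].
  apply: (@differentiable_comp _ _ _ _ F (fun N : 'rV[R]_n => N 0 j : R^o)) => //.
  exact: differentiable_coord.
rewrite (_ : F = \sum_(j < n) (fun y => F y 0 j *: delta_mx 0 j)).
  by apply: differentiable_sum => j; exact: differentiableZl.
by apply/funext => y; rewrite fct_sumE [LHS]row_sum_delta.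
Qed.

Lemma derive_row F x v j : differentiable F x ->
  ('D_v F x) 0 j = 'D_v (fun y => F y 0 j : R^o) x.
Proof. by move=> /diff_derivable dF; rewrite derive_mx// mxE. Qed.

(** Everything below is computed for real-valued functions; this carries it
    over to the components of vectors. *)
Lemma Ck_rowP k F U : open U ->
  Ck k F U <-> forall j, Ck k (fun x => F x 0 j : R^o) U.
Proof.
move=> Uo; elim: k F => [|k IH] F /=.
  split=> [HF j x Ux|HF x Ux].
    apply: (@continuous_comp _ _ _ F (fun N : 'rV[R]_n => N 0 j : R^o)).
      exact: HF.
    exact: coord_continuous.
  rewrite (_ : F = fun y => \sum_(j < n) F y 0 j *: delta_mx 0 j); last first.
    by apply/funext => y; rewrite [LHS]row_sum_delta.
  apply: (@Ck_sum _ _ _ 0 _ _ (fun j y => F y 0 j *: delta_mx 0 j) U) => // j.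
  by move=> y Uy; apply: cvgZr_tmp; exact: HF.
split=> [[dF HF] j|HF].
  split=> [x Ux|v]; first exact: (differentiable_rowP _ _).1 (dF x Ux) j.
  apply: Ck_eq ((IH _).1 (HF v) j) => // x Ux; exact/derive_row/dF.
have dF x : U x -> differentiable F x.
  by move=> Ux; apply/differentiable_rowP => j; exact: (HF j).1.
split=> [|v]; first exact: dF.
apply/IH => j; apply: Ck_eq ((HF j).2 v) => // x Ux.
by rewrite derive_row//; exact: dF.
Qed.

End CkRow.

Section Chain.
Context {R : realType} {V W : normedModType R} {n : nat}.

Lemma derive_rowE (f : 'rV[R]_n -> W) (x v : 'rV[R]_n) :
  differentiable f x -> 'D_v f x = \sum_(j < n) v 0 j *: 'D_(delta_mx 0 j) f x.
Proof.
move=> df; rewrite deriveE// [in LHS](row_sum_delta v) linear_sum.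
by apply: eq_bigr => j _; rewrite linearZ -deriveE.
Qed.

Lemma derive_comp (F : V -> 'rV[R]_n) (f : 'rV[R]_n -> W) (x v : V) :
  differentiable F x -> differentiable f (F x) ->
  'D_v (f \o F) x = 'D_('D_v F x) f (F x).
Proof.
move=> dF df; rewrite [LHS]deriveE; last exact: differentiable_comp.
by rewrite diff_comp// [RHS]deriveE// [in RHS]deriveE.
Qed.

End Chain.

Section CkComp.
Context {R : realType} {V : normedModType R} {n : nat}.

Lemma Ck_comp k (F : V -> 'rV[R]_n) (f : 'rV[R]_n -> R^o) U A :
  open U -> (forall x, U x -> A (F x)) -> Ck k F U -> Ck k f A ->
  Ck k (f \o F) U.
Proof.
move=> Uo FUA; elim: k f => [|k IH] f.
  move=> /= HF Hf x Ux; apply: continuous_comp; first exact: HF.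
  exact/Hf/FUA.
move=> HF Hf.
split=> [x Ux|v].
  by apply: differentiable_comp; [exact: HF.1|exact/Hf.1/FUA].
apply: (@Ck_eq _ _ _ _
  (fun x => \sum_(j < n) (('D_v F x) 0 j : R^o) *
       (('D_(delta_mx 0 j) f) \o F) x)) => //.
  move=> x Ux; have dF := HF.1 x Ux; have df := Hf.1 _ (FUA x Ux).
  by rewrite derive_comp// derive_rowE.
apply: Ck_sum => // j; apply: CkM => //; first exact: ((Ck_rowP _ _ _).1 (HF.2 v)).
by apply: IH; [exact: CkW|exact: Hf.2].
Qed.

End CkComp.

(** * Symmetry of second derivatives *)

Section Schwarz.
Context {R : realType} {V : normedModType R}.
Implicit Types (f : V -> R^o) (U : set V).

Lemma is_derive_line f (y u : V) (s : R) : differentiable f (y + s *: u) ->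
  is_derive s 1 (fun s => f (y + s *: u) : R) ('D_u f (y + s *: u)).
Proof.
move=> /(@diff_derivable _ _ _ _ _ u) df.
have E : (fun h : R => h^-1 *: (f (y + (h *: 1 + s) *: u) - f (y + s *: u))) =
         (fun h => h^-1 *: (f (h *: u + (y + s *: u)) - f (y + s *: u))).
  apply/funext => h; congr (_ *: (f _ - _)).
  by rewrite [h *: 1]mulr1 scalerDl addrCA.
by apply: DeriveDef; rewrite /derivable /derive /= E.
Qed.

(** Apply the mean value theorem in the direction [u] to the increment of [f]
    along [v], then in the direction [v]. *)
Lemma second_difference_mvt U f (x u v : V) (h : R) : 0 < h -> Ck 2 f U ->
  (forall s t, 0 <= s <= h -> 0 <= t <= h -> U (x + s *: u + t *: v)) ->
  exists s t, [/\ 0 <= s <= h, 0 <= t <= h &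
    (f (x + h *: u + h *: v) : R) - f (x + h *: u) - (f (x + h *: v) - f x) =
      'D_v ('D_u f) (x + s *: u + t *: v) * h * h].
Proof.
move=> h0 fU HU.
have itvP0 (s : R) : s \in `[0, h] -> 0 <= s <= h by rewrite in_itv.
have h0h : 0 <= h <= h by rewrite le_refl ltW.
have z0h : 0 <= (0 : R) <= h by rewrite le_refl ltW.
have addz (y w : V) : y + 0 *: w = y by rewrite scale0r addr0.
have HU0 s : 0 <= s <= h -> U (x + s *: u).
  by move=> sh; have := HU s 0 sh z0h; rewrite addz.
pose phi (s : R) : R := f (x + s *: u + h *: v) - f (x + s *: u).
pose dphi (s : R) : R :=
  'D_u f (x + s *: u + h *: v) - 'D_u f (x + s *: u).
have phiD s : s \in `[0, h] -> is_derive s 1 phi (dphi s).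
  move=> /itvP0 sh; apply: is_deriveB.
    have E r : x + r *: u + h *: v = x + h *: v + r *: u by rewrite addrAC.
    under eq_fun do rewrite E.
    rewrite E; apply: is_derive_line; rewrite -E; apply: fU.1; exact: HU.
  by apply: is_derive_line; exact/fU.1/HU0.
have subitv (s : R) : s \in `]0, h[ -> s \in `[0, h].
  by rewrite !in_itv/= => /andP[/ltW -> /ltW ->].
have [s sh phiE] := MVT h0 (fun s sh => phiD s (subitv s sh))
  (derivable_within_continuous (fun s sh => @ex_derive _ _ _ _ _ _ _ (phiD s sh))).
have {}sh := itvP0 _ (subitv _ sh).
have dfU := fU.2 u.
have psiD t : t \in `[0, h] -> is_derive t 1
    (fun t => 'D_u f (x + s *: u + t *: v) : R)
    ('D_v ('D_u f) (x + s *: u + t *: v)).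
  by move=> /itvP0 th; apply: is_derive_line; apply: dfU.1; exact: HU.
have [t th psiE] := MVT h0 (fun t th => psiD t (subitv t th))
  (derivable_within_continuous (fun t th => @ex_derive _ _ _ _ _ _ _ (psiD t th))).
exists s, t; split=> //; first exact: itvP0 (subitv _ th).
move: phiE psiE; rewrite /phi /dphi !addz !subr0 => -> ->.
by [].
Qed.

Lemma derive_symmetric U f (x u v : V) : open U -> U x -> Ck 2 f U ->
  'D_v ('D_u f) x = 'D_u ('D_v f) x.
Proof.
move=> Uo Ux fU; apply/eqP; rewrite -subr_eq0 -normr_le0.
apply/ler_addgt0Pr => e e0; rewrite add0r.
have e20 : 0 < e / 2 by rewrite divr_gt0.
have cont (a b : V) : \forall y \near x, `|'D_b ('D_a f) x - 'D_b ('D_a f) y| < e / 2.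
  have : {for x, continuous ('D_b ('D_a f) : V -> R^o)}.
    exact: ((fU.2 a).2 b).
  by move=> /cvgrPdist_lt; exact.
have : \forall y \near x, [/\ U y,
    `|'D_v ('D_u f) x - 'D_v ('D_u f) y| < e / 2 &
    `|'D_u ('D_v f) x - 'D_u ('D_v f) y| < e / 2].
  have nU : \forall y \near x, U y by exact: open_nbhs_nbhs.
  by apply: filterS3 nU (cont u v) (cont v u).
move=> /nbhs_ballP[d /= d0 Hd].
(* The [1] keeps the denominator positive when [u] and [v] are both zero. *)
pose h := d / (`|u| + `|v| + 1).
have K0 : 0 < `|u| + `|v| + 1 by rewrite ltr_wpDl// addr_ge0.
have h0 : 0 < h by rewrite divr_gt0.
have near_x s t : 0 <= s <= h -> 0 <= t <= h -> ball x d (x + s *: u + t *: v).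
  move=> /andP[s0 sh] /andP[t0 th]; rewrite -ball_normE /= opprD addrA.
  rewrite opprD addNKr -opprD normrN.
  apply: le_lt_trans (ler_normD _ _) _; rewrite !normrZ !ger0_norm//.
  apply: (@le_lt_trans _ _ (h * (`|u| + `|v|))).
    by rewrite mulrDr lerD// ler_wpM2r.
  by rewrite -[ltRHS](@divfK _ (`|u| + `|v| + 1)) ?gt_eqF// ltr_pM2l// ltrDl.
have [s [t [sh th st]]] := second_difference_mvt h0 fU
  (fun s t sh th => let: And3 Uy _ _ := Hd _ (near_x s t sh th) in Uy).
have near_x' s' t' : 0 <= s' <= h -> 0 <= t' <= h ->
    ball x d (x + s' *: v + t' *: u).
  by move=> sh' th'; rewrite addrAC; exact: near_x.
have [s' [t' [sh' th' st']]] := second_difference_mvt h0 fU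
  (fun s t sh th => let: And3 Uy _ _ := Hd _ (near_x' s t sh th) in Uy).
(* The second difference is symmetric in [u] and [v], so both mixed derivatives
   take a common value near [x]. *)
have eqD : 'D_v ('D_u f) (x + s *: u + t *: v) =
    'D_u ('D_v f) (x + s' *: v + t' *: u) :> R.
  move: st st'; rewrite [x + h *: v + _]addrAC.
  set A : R := 'D_v _ _; set B : R := 'D_u _ _.
  set d1 : R := f _; set d2 : R := f _; set d3 : R := f _; set d4 : R := f _.
  move=> stA stB; apply: (mulIf (lt0r_neq0 h0)); apply: (mulIf (lt0r_neq0 h0)).
  by rewrite -[LHS]stA -[RHS]stB !opprB !addrA [LHS]addrAC [RHS]addrAC; congr (_ + _); exact: addrAC.
have [_ + _] := Hd _ (near_x _ _ sh th).
have [_ _ +] := Hd _ (near_x' _ _ sh' th').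
rewrite -eqD; move: ('D_v ('D_u f) x : R) ('D_u ('D_v f) x : R) ('D_v _ _ : R).
move=> a b c bc ac; have -> : a - b = (a - c) - (b - c) by rewrite opprB addrA subrK.
apply: le_trans (ler_normB _ _) _.
by rewrite [e]splitr; apply: lerD; exact: ltW.
Qed.

End Schwarz.

(** * Smooth functions on a manifold *)

Section SmoothOn.
Context {R : realType} {V W : normedModType R}.

Lemma smooth_on_differentiable (f : V -> W) U x :
  smooth_on f U -> U x -> differentiable f x.
Proof. by move=> fU; exact: (fU 1%N).1. Qed.

Lemma smooth_on_derive (f : V -> W) U v : smooth_on f U -> smooth_on ('D_v f) U.
Proof. by move=> fU k; exact: (fU k.+1).2. Qed.

End SmoothOn.

Section Charts.
Context {R : realType} {n : nat} {M : manifold R n}.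
Implicit Types (a b : atlas M) (p : M) (U A : set M).

Lemma chart_invK a x : (chart a @` dom a) x -> chart a (chart_inv a x) = x.
Proof. by move=> [p ap <-]; rewrite chartK. Qed.

Lemma open_chart_image a U : open U -> open (chart a @` (dom a `&` U)).
Proof.
move=> Uo; rewrite openE => _ [p [ap Up] <-].
have cp : (chart a @` dom a) (chart a p) by exists p.
have : \forall y \near chart a p, (dom a `&` U) (chart_inv a y).
  apply: (chart_inv_continuous cp); rewrite chartK//.
  by apply: open_nbhs_nbhs; split=> //; apply: openI => //; exact: dom_open.
have : \forall y \near chart a p, (chart a @` dom a) y.
  by apply: open_nbhs_nbhs; split=> //; exact: codom_open.
by rewrite /interior; apply: filterS2 => _ [q aq <-]; rewrite chartK// => ?; exists q.
Qed.

End Charts.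

Section SmoothFun.
Context {R : realType} {n : nat} {M : manifold R n} {W : normedModType R}.
Implicit Types (F G : M -> W) (U A : set M).

Lemma smooth_fun_sub F A U : A `<=` U -> smooth_fun F U -> smooth_fun F A.
Proof.
by move=> AU FU a k; apply: Ck_sub (FU a k) => _ [p [ap /AU Up] <-]; exists p.
Qed.

Lemma smooth_fun_local F U :
  (forall p, U p -> exists2 A : set M, A p & smooth_fun F A) -> smooth_fun F U.
Proof.
move=> H a k; apply: Ck_local => _ [p [ap /H[A Ap FA]] <-].
by exists (chart a @` (dom a `&` A)); [exists p|exact: FA].
Qed.

Lemma smooth_fun_eq F G U : open U -> (forall p, U p -> F p = G p) ->
  smooth_fun F U -> smooth_fun G U.
Proof.
move=> Uo FG FU a k; apply: Ck_eq (FU a k); first exact: open_chart_image.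
by move=> _ [p [ap Up] <-] /=; rewrite chartK// FG.
Qed.

Lemma smooth_fun_cst (c : W) U : smooth_fun (fun _ : M => c) U.
Proof. by move=> a k; exact: Ck_cst. Qed.

Lemma smooth_funD F G U : open U -> smooth_fun F U -> smooth_fun G U ->
  smooth_fun (fun p => F p + G p) U.
Proof. by move=> Uo FU GU a k; exact (CkD (open_chart_image Uo) (FU a k) (GU a k)). Qed.

Lemma smooth_fun_sum (I : Type) (s : seq I) (F : I -> M -> W) U : open U ->
  (forall i, smooth_fun (F i) U) -> smooth_fun (fun p => \sum_(i <- s) F i p) U.
Proof.
move=> Uo FU a k.
by apply: (@Ck_sum _ _ _ _ _ _ (fun i => F i \o chart_inv a));
  [exact: open_chart_image|move=> i; exact: FU].
Qed.

Lemma deriv_eq F G U p v : open U -> U p -> (forall q, U q -> F q = G q) ->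
  deriv F p v = deriv G p v.
Proof.
move=> Uo Up FG; apply: near_eq_derive.
apply: (@near_open _ _ (chart (chart_at p) @` (dom (chart_at p) `&` U))).
- exact: open_chart_image.
- by exists p => //; split=> //; exact: dom_chart_at.
- by move=> _ [q [cq Uq] <-] /=; rewrite chartK// FG.
Qed.

Lemma smooth_fun_differentiable F U a p : smooth_fun F U -> dom a p -> U p ->
  differentiable (F \o chart_inv a) (chart a p).
Proof.
by move=> FU ap Up; apply: (smooth_on_differentiable (FU a)); exists p.
Qed.

Lemma deriv_linear F U p c v w : smooth_fun F U -> U p ->
  deriv F p (c *: v + w) = c *: deriv F p v + deriv F p w.
Proof.
move=> FU Up; have dF := smooth_fun_differentiable FU (dom_chart_at p) Up.
by rewrite /deriv !(deriveE _ dF) linearP.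
Qed.

Lemma deriv_add F G U p v : smooth_fun F U -> smooth_fun G U -> U p ->
  deriv (fun q => F q + G q) p v = deriv F p v + deriv G p v.
Proof.
move=> FU GU Up; have cp := dom_chart_at p.
have dF := smooth_fun_differentiable FU cp Up.
have dG := smooth_fun_differentiable GU cp Up.
by rewrite /deriv -deriveD//; exact: diff_derivable.
Qed.

Lemma deriv_cst (c : W) p v : deriv (fun _ : M => c) p v = 0.
Proof. exact: derive_cst. Qed.

Lemma deriv_sum (I : Type) (s : seq I) (F : I -> M -> W) U p v : open U ->
  (forall i, smooth_fun (F i) U) -> U p ->
  deriv (fun q => \sum_(i <- s) F i q) p v = \sum_(i <- s) deriv (F i) p v.
Proof.
move=> Uo FU Up; elim: s => [|i s IH].
  by under eq_fun do rewrite big_nil; rewrite deriv_cst big_nil.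
under eq_fun do rewrite big_cons.
by rewrite big_cons -IH (deriv_add _ (FU i) (smooth_fun_sum s Uo FU)).
Qed.

End SmoothFun.

Section SmoothScalar.
Context {R : realType} {n : nat} {M : manifold R n}.
Implicit Types (f g : M -> R^o) (U A : set M).

Lemma smooth_funM f g U : open U -> smooth_fun f U -> smooth_fun g U ->
  smooth_fun (fun p => f p * g p : R^o) U.
Proof. by move=> Uo fU gU a k; exact (CkM (open_chart_image Uo) (fU a k) (gU a k)). Qed.

Lemma smooth_funV f U : open U -> (forall p, U p -> f p != 0) -> smooth_fun f U ->
  smooth_fun (fun p => (f p)^-1 : R^o) U.
Proof.
move=> Uo f0 fU a k; apply: (CkV (open_chart_image Uo) _ (fU a k)).
by move=> _ [p [ap Up] <-] /=; rewrite chartK//; exact: f0.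
Qed.

Lemma smooth_fun_prod (I : Type) (s : seq I) (F : I -> M -> R^o) U : open U ->
  (forall i, smooth_fun (F i) U) ->
  smooth_fun (fun p => \prod_(i <- s) F i p : R^o) U.
Proof.
move=> Uo FU a k.
by apply: (@Ck_prod _ _ _ _ _ (fun i => F i \o chart_inv a));
  [exact: open_chart_image|move=> i; exact: FU].
Qed.

Lemma deriv_mul f g U p v : smooth_fun f U -> smooth_fun g U -> U p ->
  deriv (fun q => f q * g q : R^o) p v = f p * deriv g p v + g p * deriv f p v :> R.
Proof.
move=> fU gU Up; have cp := dom_chart_at p.
have df := diff_derivable (v := v) (smooth_fun_differentiable fU cp Up).
have dg := diff_derivable (v := v) (smooth_fun_differentiable gU cp Up).
rewrite /deriv; have := deriveM df dg.
by rewrite /= !(chartK cp).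
Qed.

End SmoothScalar.

Section SmoothRow.
Context {R : realType} {n m : nat} {M : manifold R n}.
Implicit Types (F : M -> 'rV[R]_m) (U : set M).

Lemma smooth_fun_rowP F U : open U ->
  smooth_fun F U <-> forall j, smooth_fun (fun p => F p 0 j : R^o) U.
Proof.
move=> Uo; split=> [FU j a k|FU a k].
  exact: ((Ck_rowP _ _ (open_chart_image Uo)).1 (FU a k) j).
by apply/(Ck_rowP _ _ (open_chart_image Uo)) => j; exact: FU.
Qed.

Lemma deriv_row F U p v j : smooth_fun F U -> U p ->
  (deriv F p v) 0 j = deriv (fun q => F q 0 j : R^o) p v.
Proof.
move=> FU Up; apply: derive_row.
exact: smooth_fun_differentiable FU (dom_chart_at p) Up.
Qed.

End SmoothRow.

(** * Charts and coordinate fields *)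

Section Coordinates.
Context {R : realType} {n : nat} {M : manifold R n}.
Implicit Types (a b : atlas M) (p : M) (U A : set M).

(** Unlike [deriv], differentiates at every point in the same chart, along the
    same components, and can therefore be iterated. *)
Definition partial {W : normedModType R} a (v : 'rV[R]_n) (F : M -> W) (q : M) : W :=
  'D_v (F \o chart_inv a) (chart a q).

Lemma smooth_chart a : smooth_fun (chart a) (dom a).
Proof. by move=> b; exact: transition_smooth. Qed.

Lemma smooth_chart_coord a j : smooth_fun (fun q => chart a q 0 j : R^o) (dom a).
Proof. exact: ((smooth_fun_rowP _ (dom_open a)).1 (smooth_chart a)). Qed.

Lemma tcoord_row a p v j : dom a p ->
  tcoord a p v 0 j = deriv (fun q => chart a q 0 j : R^o) p v.
Proof. exact: deriv_row (smooth_chart a). Qed.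

Lemma tcoord_linear a p c v w : dom a p ->
  tcoord a p (c *: v + w) = c *: tcoord a p v + tcoord a p w.
Proof. exact: deriv_linear (smooth_chart a). Qed.

(** [deriv] is computed in the chart selected at [p]; by the chain rule any
    other chart around [p] gives the same value. *)
Lemma deriv_partial {W : normedModType R} (F : M -> W) U a p v :
  open U -> smooth_fun F U -> dom a p -> U p ->
  deriv F p v = partial a (tcoord a p v) F p.
Proof.
move=> Uo FU ap Up; set c := chart_at p; have cp : dom c p := dom_chart_at p.
have dF := smooth_fun_differentiable FU ap Up.
have da := smooth_fun_differentiable (@smooth_chart a) cp ap.
have E : (chart a \o chart_inv c) (chart c p) = chart a p by rewrite /= chartK.
rewrite /partial -E -derive_comp//; last by rewrite E.
apply: near_eq_derive.
apply: (@near_open _ _ (chart c @` (dom c `&` (dom a `&` U)))).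
- by apply/open_chart_image/openI => //; exact: dom_open.
- by exists p.
- by move=> _ [q [cq [aq Uq]] <-] /=; rewrite !chartK.
Qed.

Lemma deriv_coord (f : M -> R^o) U a p v :
  open U -> smooth_fun f U -> dom a p -> U p ->
  deriv f p v = \sum_i tcoord a p v 0 i * partial a (delta_mx 0 i) f p :> R.
Proof.
move=> Uo fU ap Up; rewrite (deriv_partial _ Uo fU ap Up).
exact: derive_rowE (smooth_fun_differentiable fU ap Up).
Qed.

Lemma smooth_partial (f : M -> R^o) U a v : open U -> smooth_fun f U ->
  smooth_fun (partial a v f) (dom a `&` U).
Proof.
move=> Uo fU b k.
have aUo : open (dom a `&` U) by apply: openI => //; exact: dom_open.
apply: (@Ck_comp _ _ _ _ (chart a \o chart_inv b) ('D_v (f \o chart_inv a)) _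
  (chart a @` (dom a `&` U))).
- exact: open_chart_image.
- by move=> _ [p [bp [ap Up]] <-] /=; rewrite chartK//; exists p.
- apply: Ck_sub (transition_smooth b a k).
  by move=> _ [p [bp [ap Up]] <-]; exists p.
- exact: smooth_on_derive (fU a) k.
Qed.

(** The transition maps between two charts are inverse to each other, hence
    so are their differentials, by the chain rule. *)
Lemma derive_transition a b p v : dom a p -> dom b p ->
  'D_('D_v (chart a \o chart_inv b) (chart b p)) (chart b \o chart_inv a)
    (chart a p) = v.
Proof.
move=> ap bp.
have da := smooth_fun_differentiable (@smooth_chart a) bp ap.
have db := smooth_fun_differentiable (@smooth_chart b) ap bp.
have E : (chart a \o chart_inv b) (chart b p) = chart a p by rewrite /= chartK.
rewrite -{1}E -derive_comp//; last by rewrite E.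
rewrite -[RHS](derive_id (chart b p) v); apply: near_eq_derive.
apply: (@near_open _ _ (chart b @` (dom b `&` dom a))).
- exact/open_chart_image/dom_open.
- by exists p.
- by move=> _ [q [bq aq] <-] /=; rewrite !chartK.
Qed.

(** [tcoord] and [coord_field] are the differentials of the two transition
    maps between [a] and the chart selected at [p]. *)
Lemma coord_fieldK a p v : dom a p -> tcoord a p (coord_field a v p) = v.
Proof. by move=> ap; exact: derive_transition (dom_chart_at p) ap. Qed.

Lemma tcoordK a p v : dom a p -> coord_field a (tcoord a p v) p = v.
Proof. by move=> ap; exact: derive_transition ap (dom_chart_at p). Qed.

Lemma deriv_coord_field (f : M -> R^o) U a p v :
  open U -> smooth_fun f U -> dom a p -> U p ->
  deriv f p (coord_field a v p) = partial a v f p.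
Proof.
by move=> Uo fU ap Up; rewrite (deriv_partial _ Uo fU ap Up) coord_fieldK.
Qed.

Lemma coord_field_sum a p v : dom a p ->
  coord_field a v p = \sum_i v 0 i *: coord_field a (delta_mx 0 i) p.
Proof.
move=> ap; rewrite /coord_field derive_rowE//.
exact: smooth_fun_differentiable (@smooth_chart _) ap (dom_chart_at p).
Qed.

Lemma tcoord_sum a p v : dom a p ->
  v = \sum_i tcoord a p v 0 i *: coord_field a (delta_mx 0 i) p.
Proof. by move=> ap; rewrite -coord_field_sum// tcoordK. Qed.

Lemma tcoord_comb a p (I : Type) (s : seq I) (c : I -> R) (v : I -> 'rV[R]_n) :
  dom a p ->
  tcoord a p (\sum_(i <- s) c i *: v i) = \sum_(i <- s) c i *: tcoord a p (v i).
Proof.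
move=> ap; elim: s => [|i s IH].
  by rewrite !big_nil /tcoord /deriv derive0.
by rewrite !big_cons tcoord_linear// IH.
Qed.

Lemma coord_field_chart_at p v : coord_field (chart_at p) v p = v.
Proof.
rewrite /coord_field -[RHS](derive_id (chart (chart_at p) p) v).
apply: near_eq_derive; have ap := dom_chart_at p.
apply: (@near_open _ _ (chart (chart_at p) @` dom (chart_at p))).
- exact: codom_open.
- by exists p.
- exact: chart_invK.
Qed.

Lemma tcoord_chart_at p v : tcoord (chart_at p) p v = v.
Proof. by have := coord_fieldK v (dom_chart_at p); rewrite coord_field_chart_at. Qed.

End Coordinates.

(** * Smooth vector fields and the Lie bracket *)

Section VectorFields.
Context {R : realType} {n : nat} {M : manifold R n}.
Implicit Types (a b : atlas M) (p : M) (U A : set M) (X Y : vfield M).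

Lemma smooth_vf_sub X A U : A `<=` U -> smooth_vf X U -> smooth_vf X A.
Proof.
by move=> AU XU a; apply: smooth_fun_sub (XU a) => p [ap /AU Up].
Qed.

Lemma smooth_vf_coord X U a j : open U -> smooth_vf X U ->
  smooth_fun (fun q => tcoord a q (X q) 0 j : R^o) (dom a `&` U).
Proof.
move=> Uo XU; have aUo : open (dom a `&` U) by apply: openI => //; exact: dom_open.
exact: ((smooth_fun_rowP _ aUo).1 (XU a)).
Qed.

(** The components of [X] are the derivatives along [X] of the coordinate
    functions, so smoothness of [X] is a statement on scalar functions. *)
Lemma smooth_vf_chart_deriv X U : open U ->
  (forall a j, smooth_fun
    (fun q => deriv (fun r => chart a r 0 j : R^o) q (X q)) (dom a `&` U)) ->
  smooth_vf X U.
Proof.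
move=> Uo H a; have aUo : open (dom a `&` U) by apply: openI => //; exact: dom_open.
apply/smooth_fun_rowP => // j; apply: smooth_fun_eq (H a j) => // p [ap _].
by rewrite tcoord_row.
Qed.

(** Near a point [X f] is the sum of the products of the components of [X] by
    the partial derivatives of [f] in one fixed chart. *)
Lemma smooth_deriv (f : M -> R^o) U X : open U -> smooth_fun f U ->
  smooth_vf X U -> smooth_fun (fun q => deriv f q (X q)) U.
Proof.
move=> Uo fU XU; apply: smooth_fun_local => p Up; set a := chart_at p.
have ap : dom a p := dom_chart_at p.
have aUo : open (dom a `&` U) by apply: openI => //; exact: dom_open.
exists (dom a `&` U) => //.
apply: (@smooth_fun_eq _ _ _ _
    (fun q => \sum_i tcoord a q (X q) 0 i * partial a (delta_mx 0 i) f q)) => //.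
  by move=> q [aq Uq]; rewrite (deriv_coord _ Uo fU aq Uq).
apply: smooth_fun_sum => // i; apply: smooth_funM => //.
  exact: smooth_vf_coord.
exact: smooth_partial.
Qed.

Lemma smooth_coord_field a v : smooth_vf (coord_field a v) (dom a).
Proof.
have ao := dom_open a.
apply: smooth_vf_chart_deriv => // b j.
have bo := dom_open b; have boa : open (dom b `&` dom a) by exact: openI.
have cb := smooth_chart_coord b j.
apply: (@smooth_fun_eq _ _ _ _ (partial a v (fun r => chart b r 0 j : R^o))) => //.
  by move=> p [bp ap]; rewrite (deriv_coord_field _ bo cb ap bp).
by rewrite setIC; exact: smooth_partial.
Qed.

Lemma smooth_vf_comb (f : M -> R^o) X Y U : open U ->
  smooth_fun f U -> smooth_vf X U -> smooth_vf Y U ->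
  smooth_vf (fun q => (f q : R) *: X q + Y q) U.
Proof.
move=> Uo fU XU YU; apply: smooth_vf_chart_deriv => // a j.
have ao := dom_open a; have aUo : open (dom a `&` U) by exact: openI.
apply: (@smooth_fun_eq _ _ _ _ (fun q =>
  f q * tcoord a q (X q) 0 j + tcoord a q (Y q) 0 j)) => //.
  by move=> p [ap Up]; rewrite -tcoord_row// tcoord_linear// !mxE.
apply: smooth_funD => //; last exact: smooth_vf_coord.
apply: smooth_funM => //; last exact: smooth_vf_coord.
by apply: smooth_fun_sub fU.
Qed.

Lemma smooth_vf0 U : open U -> smooth_vf (fun _ : M => 0) U.
Proof.
move=> Uo; apply: smooth_vf_chart_deriv => // a j.
have ao := dom_open a; have aUo : open (dom a `&` U) by exact: openI.
apply: (@smooth_fun_eq _ _ _ _ (fun=> 0)) => //; last exact: smooth_fun_cst.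
by move=> p [ap _]; rewrite -tcoord_row// /tcoord /deriv derive0 mxE.
Qed.

Lemma smooth_vf_sum (I : Type) (s : seq I) (f : I -> M -> R^o) (X : I -> vfield M) U :
  open U -> (forall i, smooth_fun (f i) U) -> (forall i, smooth_vf (X i) U) ->
  smooth_vf (fun q => \sum_(i <- s) (f i q : R) *: X i q) U.
Proof.
move=> Uo fU XU; elim: s => [|i s IH].
  by under eq_fun do rewrite big_nil; exact: smooth_vf0.
by under eq_fun do rewrite big_cons; exact: (smooth_vf_comb Uo (fU i) (XU i) IH).
Qed.

Lemma smooth_vf_local X U :
  (forall p, U p -> exists2 A : set M, A p & smooth_vf X A) -> smooth_vf X U.
Proof.
move=> H a; apply: smooth_fun_local => p [ap /H[A Ap XA]].
by exists (dom a `&` A).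
Qed.

Lemma smooth_vf_eq X Y U : open U -> (forall p, U p -> X p = Y p) ->
  smooth_vf X U -> smooth_vf Y U.
Proof.
move=> Uo XY XU a; have ao := dom_open a; have aUo : open (dom a `&` U) by exact: openI.
by apply: (smooth_fun_eq aUo _ (XU a)) => p [_ Up]; rewrite XY.
Qed.

Lemma partial_symmetric (f : M -> R^o) U a p v w :
  open U -> smooth_fun f U -> dom a p -> U p ->
  partial a v (partial a w f) p = partial a w (partial a v f) p.
Proof.
move=> Uo fU ap Up.
have E u1 u2 : partial a u1 (partial a u2 f) p =
    'D_u1 ('D_u2 (f \o chart_inv a)) (chart a p).
  apply: near_eq_derive.
  apply: (@near_open _ _ (chart a @` (dom a `&` U))).
  - exact: open_chart_image.
  - by exists p.
  - by move=> _ [q [aq Uq] <-] /=; rewrite /partial chartK.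
rewrite !E; apply: derive_symmetric (fU a 2%N); first exact: open_chart_image.
by exists p.
Qed.

(** In the chart around [p] the second derivatives of [f] cancel by symmetry, so
    the commutator of [X] and [Y] as derivations is the first-order operator
    given by the bracket. *)
Lemma deriv_lie (f : M -> R^o) U X Y p : open U -> U p -> smooth_fun f U ->
  smooth_vf X U -> smooth_vf Y U ->
  deriv f p (lie X Y p) =
    deriv (fun q => deriv f q (Y q)) p (X p) -
    deriv (fun q => deriv f q (X q)) p (Y p) :> R.
Proof.
move=> Uo Up fU XU YU; set a := chart_at p.
have ap : dom a p := dom_chart_at p.
have ao := dom_open a; have aUo : open (dom a `&` U) by exact: openI.
have aUp : (dom a `&` U) p by [].
have tp v : tcoord a p v = v := tcoord_chart_at p v.
pose d i := partial a (delta_mx 0 i) f.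
have dU i : smooth_fun (d i : M -> R^o) (dom a `&` U) by exact: smooth_partial.
have D1 (Z1 Z2 : vfield M) : smooth_vf Z1 U -> smooth_vf Z2 U ->
  deriv (fun q => deriv f q (Z2 q)) p (Z1 p) =
   \sum_i (deriv (fun q => tcoord a q (Z2 q)) p (Z1 p)) 0 i * d i p +
   \sum_i \sum_j Z1 p 0 j * Z2 p 0 i *
      partial a (delta_mx 0 j) (d i) p :> R.
  move=> Z1U Z2U.
  have Z2s i := smooth_vf_coord a i Uo Z2U.
  rewrite (@deriv_eq _ _ _ _ _
    (fun q => \sum_i tcoord a q (Z2 q) 0 i * d i q) (dom a `&` U))//; last first.
    by move=> q [aq Uq]; rewrite (deriv_coord _ Uo fU aq Uq).
  rewrite (deriv_sum _ _ aUo _ aUp); last first.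
    by move=> i; apply: smooth_funM.
  rewrite -big_split; apply: eq_bigr => i _ /=.
  have e1 : deriv (d i : M -> R^o) p (Z1 p) =
      \sum_j Z1 p 0 j * partial a (delta_mx 0 j) (d i) p :> R.
    by rewrite (deriv_coord _ aUo (dU i) ap aUp) tp.
  rewrite (deriv_mul _ (Z2s i) (dU i) aUp) e1 -(deriv_row _ _ (Z2U a) aUp) tp.
  rewrite mulr_sumr [LHS]addrC [X in X + _ = _]mulrC; apply: f_equal.
  by apply: eq_bigr => j _; rewrite mulrCA mulrA.
rewrite (D1 X Y)// (D1 Y X)// (deriv_coord _ Uo fU ap Up) tp /lie -/a.
set s1 := \sum_i \sum_j _; set s2 := \sum_i \sum_j _.
have -> : s1 = s2.
  rewrite /s1 exchange_big; apply: eq_bigr => i _; apply: eq_bigr => j _ /=.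
  by rewrite (partial_symmetric _ _ Uo fU ap Up) [Y p 0 j * _]mulrC.
have cancel (x y z : R) : x + z - (y + z) = x - y.
  by rewrite opprD addrACA subrr addr0.
rewrite [RHS]cancel -sumrB; apply: eq_bigr => i _.
by rewrite !mxE mulrBl.
Qed.

(** The components of [lie X Y] are obtained by applying the commutator of
    [X] and [Y] to the coordinate functions. *)
Lemma smooth_lie X Y U : open U -> smooth_vf X U -> smooth_vf Y U ->
  smooth_vf (lie X Y) U.
Proof.
move=> Uo XU YU; apply: smooth_vf_chart_deriv => // a j.
have ao := dom_open a; have aUo : open (dom a `&` U) by exact: openI.
have XaU : smooth_vf X (dom a `&` U) by apply: smooth_vf_sub XU.
have YaU : smooth_vf Y (dom a `&` U) by apply: smooth_vf_sub YU.
have ca : smooth_fun (fun r => chart a r 0 j : R^o) (dom a `&` U).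
  by apply: smooth_fun_sub (smooth_chart_coord a j).
apply: (@smooth_fun_eq _ _ _ _ (fun q =>
   deriv (fun q => deriv (fun r => chart a r 0 j : R^o) q (Y q)) q (X q) +
   (-1) * deriv (fun q => deriv (fun r => chart a r 0 j : R^o) q (X q)) q (Y q)
   : R^o)) => //.
  by move=> p aUp; rewrite (deriv_lie aUo aUp ca XaU YaU) mulN1r.
apply: smooth_funD => //; first by do 2 apply: smooth_deriv => //.
apply: smooth_funM => //; first exact: smooth_fun_cst.
by do 2 apply: smooth_deriv => //.
Qed.

End VectorFields.

(** * Push-forward along a smooth map *)

Section SmoothMap.
Context {R : realType} {m n : nat} {M : manifold R m} {N : manifold R n}.
Variable iota : M -> N.
Hypothesis iotaS : smooth_map iota.
Implicit Types (p q : M) (X Y : vfield M).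

Lemma open_smooth_preimage (V : set N) : open V -> open (iota @^-1` V).
Proof. by move: V; apply/continuousP; exact: iotaS.1. Qed.

Lemma smooth_comp (f : N -> R^o) (V : set N) : open V -> smooth_fun f V ->
  smooth_fun (f \o iota : M -> R^o) (iota @^-1` V).
Proof.
move=> Vo fV; apply: smooth_fun_local => p Vp; set b := chart_at (iota p).
have bp : dom b (iota p) := dom_chart_at (iota p).
have bo := dom_open b; have bVo : open (dom b `&` V) by exact: openI.
exists (iota @^-1` (dom b `&` V)) => // a k.
have io := open_smooth_preimage bVo.
apply: (@Ck_eq _ _ _ _ ((f \o chart_inv b) \o ((chart b \o iota) \o chart_inv a))).
- exact: open_chart_image.
- by move=> _ [q [aq [bq Vq]] <-] /=; rewrite chartK// chartK.
- apply: (@Ck_comp _ _ _ _ _ _ _ (chart b @` (dom b `&` V))).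
  + exact: open_chart_image.
  + by move=> _ [q [aq [bq Vq]] <-] /=; rewrite chartK//; exists (iota q).
  + apply: Ck_sub (iotaS.2 b a k).
    by move=> _ [q [aq [bq Vq]] <-]; exists q.
  + exact: fV.
Qed.

(** The chain rule: [push] is the differential of the map. *)
Lemma deriv_push (f : N -> R^o) (V : set N) p v : open V -> smooth_fun f V ->
  V (iota p) -> deriv (f \o iota : M -> R^o) p v = deriv f (iota p) (push iota p v).
Proof.
move=> Vo fV Vp; set b := chart_at (iota p); set a := chart_at p.
have ap : dom a p := dom_chart_at p.
have bp : dom b (iota p) := dom_chart_at (iota p).
have bo := dom_open b; have bVo : open (dom b `&` V) by exact: openI.
have io := open_smooth_preimage bVo.
have df := smooth_fun_differentiable fV bp Vp.
have di : differentiable ((chart b \o iota) \o chart_inv a) (chart a p).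
  by apply: smooth_fun_differentiable (iotaS.2 b) ap _.
have E : ((chart b \o iota) \o chart_inv a) (chart a p) = chart b (iota p).
  by rewrite /= chartK.
rewrite /push [RHS]/deriv -/b -{1}E -derive_comp//; last by rewrite E.
apply: near_eq_derive.
apply: (@near_open _ _ (chart a @` (dom a `&` (iota @^-1` (dom b `&` V))))).
- exact: open_chart_image.
- by exists p.
- by move=> _ [q [aq [bq Vq]] <-] /=; rewrite chartK// chartK.
Qed.

Lemma push_linear p c v w :
  push iota p (c *: v + w) = c *: push iota p v + push iota p w.
Proof.
apply: deriv_linear (iotaS.2 (chart_at (iota p))) _; exact: dom_chart_at.
Qed.

Lemma push0 p : push iota p 0 = 0.
Proof. by have := push_linear p (-1) 0 0; rewrite scaler0 addr0 scaleN1r addNr. Qed.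

Lemma pushB p v w : push iota p (v - w) = push iota p v - push iota p w.
Proof. by rewrite addrC -scaleN1r push_linear scaleN1r addrC. Qed.

Lemma push_sum p (I : Type) (s : seq I) (c : I -> R) (v : I -> 'rV[R]_m) :
  push iota p (\sum_(i <- s) c i *: v i) = \sum_(i <- s) c i *: push iota p (v i).
Proof.
elim: s => [|i s IH]; first by rewrite !big_nil push0.
by rewrite !big_cons push_linear IH.
Qed.

Lemma tcoord_push a p v j : dom a (iota p) ->
  tcoord a (iota p) (push iota p v) 0 j =
    deriv (fun q => chart a (iota q) 0 j : R^o) p v.
Proof.
move=> ap; rewrite tcoord_row//.
by rewrite -(deriv_push v (dom_open a) (smooth_chart_coord a j) ap).
Qed.

Lemma smooth_chart_comp a j :
  smooth_fun (fun q => chart a (iota q) 0 j : R^o) (iota @^-1` dom a).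
Proof. exact: smooth_comp (dom_open a) (smooth_chart_coord a j). Qed.

Lemma smooth_tcoord_push a X U j : open U -> smooth_vf X U ->
  smooth_fun (fun q => tcoord a (iota q) (push iota q (X q)) 0 j : R^o)
    (iota @^-1` dom a `&` U).
Proof.
move=> Uo XU; have io := open_smooth_preimage (dom_open a).
have ioU : open (iota @^-1` dom a `&` U) by exact: openI.
apply: (@smooth_fun_eq _ _ _ _ (fun q =>
  deriv (fun q => chart a (iota q) 0 j : R^o) q (X q))) => //.
  by move=> p [ap _]; rewrite tcoord_push.
apply: smooth_deriv => //.
  by apply: smooth_fun_sub (smooth_chart_comp a j).
by apply: smooth_vf_sub XU.
Qed.

(** The push-forward respects brackets: the components of [push X] are the
    derivatives along [X] of the coordinate functions pulled back by the map, and
    these are smooth functions to which the commutator formula applies. *)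
Lemma tcoord_push_lie a X Y U p j : open U -> U p -> smooth_vf X U ->
  smooth_vf Y U -> dom a (iota p) ->
  tcoord a (iota p) (push iota p (lie X Y p)) 0 j =
    deriv (fun q => tcoord a (iota q) (push iota q (Y q)) 0 j : R^o) p (X p) -
    deriv (fun q => tcoord a (iota q) (push iota q (X q)) 0 j : R^o) p (Y p) :> R.
Proof.
move=> Uo Up XU YU ap; have io := open_smooth_preimage (dom_open a).
have ioU : open (iota @^-1` dom a `&` U) by exact: openI.
have ioUp : (iota @^-1` dom a `&` U) p by [].
have XA : smooth_vf X (iota @^-1` dom a `&` U) by apply: smooth_vf_sub XU.
have YA : smooth_vf Y (iota @^-1` dom a `&` U) by apply: smooth_vf_sub YU.
have ca : smooth_fun (fun q => chart a (iota q) 0 j : R^o) (iota @^-1` dom a `&` U).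
  by apply: smooth_fun_sub (smooth_chart_comp a j).
rewrite tcoord_push// (deriv_lie ioU ioUp ca XA YA); congr (_ - _ : R).
  by apply: deriv_eq ioU ioUp _ => q [aq _]; rewrite tcoord_push.
by apply: deriv_eq ioU ioUp _ => q [aq _]; rewrite tcoord_push.
Qed.

End SmoothMap.

(** * Riemannian metrics *)

Section Metric.
Context {R : realType} {n : nat} {N : manifold R n}.
Variable g : N -> 'rV[R]_n -> 'rV[R]_n -> R.
Hypothesis gR : riemannian_metric g.
Implicit Types (p : N) (v w : 'rV[R]_n).

Lemma metric_linear_l p c v v' w : g p (c *: v + v') w = c * g p v w + g p v' w.
Proof. exact: metric_linear. Qed.

Lemma metric0l p w : g p 0 w = 0.
Proof.
by have := metric_linear_l p (-1) 0 0 w; rewrite scaler0 addr0 mulN1r addNr.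
Qed.

Lemma metricDl p v v' w : g p (v + v') w = g p v w + g p v' w.
Proof. by rewrite -[v in LHS]scale1r metric_linear_l mul1r. Qed.

Lemma metricZl p c v w : g p (c *: v) w = c * g p v w.
Proof. by rewrite -[_ *: _]addr0 metric_linear_l metric0l addr0. Qed.

Lemma metricBl p v v' w : g p (v - v') w = g p v w - g p v' w.
Proof. by rewrite metricDl -scaleN1r metricZl mulN1r. Qed.

Lemma metric_suml p (I : Type) (s : seq I) (c : I -> R) (v : I -> 'rV[R]_n) w :
  g p (\sum_(i <- s) c i *: v i) w = \sum_(i <- s) c i * g p (v i) w.
Proof.
elim: s => [|i s IH]; first by rewrite !big_nil metric0l.
by rewrite !big_cons metric_linear_l IH.
Qed.

Lemma metric_sumr p (I : Type) (s : seq I) (c : I -> R) (v : I -> 'rV[R]_n) w :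
  g p w (\sum_(i <- s) c i *: v i) = \sum_(i <- s) c i * g p w (v i).
Proof.
rewrite (metric_sym gR) metric_suml.
by apply: eq_bigr => i _; rewrite (metric_sym gR).
Qed.

Lemma metric_eq0 p v : g p v v = 0 -> v = 0.
Proof.
move=> gv; apply/eqP; apply: contraTT isT => /(metric_pos gR p).
by rewrite gv ltxx.
Qed.

End Metric.

Section InducedMetric.
Context {R : realType} {m n : nat} {M : manifold R m} {N : manifold R n}.
Variables (iota : M -> N) (g : N -> 'rV[R]_n -> 'rV[R]_n -> R).
Hypothesis iotaS : smooth_map iota.
Hypothesis gR : riemannian_metric g.

(** The push-forward of a field is only a field along the map, to which
    smoothness of the metric does not apply directly; expand it on the coordinate
    fields of the target, where it does. *)
Lemma smooth_induced_metric (X Y : vfield M) U : open U ->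
  smooth_vf X U -> smooth_vf Y U ->
  smooth_fun (fun q => g (iota q) (push iota q (X q)) (push iota q (Y q)) : R^o) U.
Proof.
move=> Uo XU YU; apply: smooth_fun_local => p Up; set a := chart_at (iota p).
have ap : dom a (iota p) := dom_chart_at (iota p).
have io := open_smooth_preimage iotaS (dom_open a).
have ioU : open (iota @^-1` dom a `&` U) by exact: openI.
exists (iota @^-1` dom a `&` U) => //.
pose E i := coord_field a (delta_mx 0 i).
pose comp (Z : vfield M) i q := tcoord a (iota q) (push iota q (Z q)) 0 i.
apply: (@smooth_fun_eq _ _ _ _ (fun q => \sum_i comp X i q *
   \sum_j comp Y j q * g (iota q) (E i (iota q)) (E j (iota q)) : R^o)) => //.
  move=> q [aq Uq].
  rewrite [push iota q (X q)](tcoord_sum _ aq) (metric_suml gR).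
  apply: eq_bigr => i _.
  by rewrite [in RHS](tcoord_sum (push iota q (Y q)) aq) (metric_sumr gR).
apply: smooth_fun_sum => // i; apply: smooth_funM => //.
  exact: smooth_tcoord_push.
apply: smooth_fun_sum => // j; apply: smooth_funM => //.
  exact: smooth_tcoord_push.
apply: (@smooth_fun_sub _ _ _ _ _ _ (iota @^-1` dom a)) => //.
have gE : smooth_fun (fun r => g r (E i r) (E j r) : R^o) (dom a).
  by apply: (metric_smooth gR) => //; [exact: dom_open|..]; exact: smooth_coord_field.
exact (smooth_comp iotaS (dom_open a) gE).
Qed.

End InducedMetric.

(** * Affine connections in coordinates *)

Section Connections.
Context {R : realType} {n : nat} {N : manifold R n}.
Variable nabla : vfield N -> vfield N -> vfield N.
Hypothesis nablaC : affine_connection nabla.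
Implicit Types (X Y : vfield N) (U : set N).

Lemma conn_sumr (I : Type) (s : seq I) (f : I -> N -> R^o) (Y : I -> vfield N)
    U X p : open U -> U p -> smooth_vf X U ->
  (forall i, smooth_fun (f i) U) -> (forall i, smooth_vf (Y i) U) ->
  nabla X (fun q => \sum_(i <- s) (f i q : R) *: Y i q) p =
  \sum_(i <- s) ((f i p : R) *: nabla X (Y i) p +
                 (deriv (f i) p (X p) : R) *: Y i p).
Proof.
move=> Uo Up XU fU YU; elim: s => [|i s IH].
  rewrite big_nil; under eq_fun do rewrite big_nil.
  have := conn_leibniz nablaC Uo (smooth_fun_cst (0 : R^o) U) XU (smooth_vf0 Uo) Up.
  rewrite deriv_cst !scale0r addr0 => n0; rewrite -[RHS]n0.
  by congr (nabla X _ p); apply/funext => q; rewrite scaler0.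
rewrite big_cons -IH; under eq_fun do rewrite big_cons.
have fYU j : smooth_vf (fun q => (f j q : R) *: Y j q) U.
  apply: (smooth_vf_eq Uo _ (smooth_vf_comb Uo (fU j) (YU j) (smooth_vf0 Uo))).
  by move=> q _; exact: addr0.
rewrite (conn_additive nablaC Uo XU (fYU i) (smooth_vf_sum s Uo fU YU) Up).
by rewrite (conn_leibniz nablaC Uo (fU i) XU (YU i) Up).
Qed.

Lemma conn_suml (I : Type) (s : seq I) (f : I -> N -> R^o) (X : I -> vfield N)
    U Y p : open U -> U p -> smooth_vf Y U ->
  (forall i, smooth_fun (f i) U) -> (forall i, smooth_vf (X i) U) ->
  nabla (fun q => \sum_(i <- s) (f i q : R) *: X i q) Y p =
  \sum_(i <- s) (f i p : R) *: nabla (X i) Y p.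
Proof.
move=> Uo Up YU fU XU; elim: s => [|i s IH].
  rewrite big_nil; under eq_fun do rewrite big_nil.
  have z := smooth_vf0 Uo (M := N).
  have := conn_linear nablaC Uo (smooth_fun_cst (-1 : R^o) U) z z YU Up.
  rewrite [X in _ = X + _ -> _]scaleN1r [X in _ = X -> _]addNr => n0.
  rewrite -[RHS]n0.
  by congr (nabla _ Y p); apply/funext => q; rewrite scaler0 addr0.
rewrite big_cons -IH; under eq_fun do rewrite big_cons.
exact: (conn_linear nablaC Uo (fU i) (XU i) (smooth_vf_sum s Uo fU XU) YU Up).
Qed.

(** [coord_field a v] has constant components, and a connection is linear over
    functions in its first argument. *)
Lemma conn_coord_field a v Y p : dom a p -> smooth_vf Y (dom a) ->
  nabla (coord_field a v) Y p =
    \sum_i v 0 i *: nabla (coord_field a (delta_mx 0 i)) Y p.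
Proof.
move=> ap Ya; have ao := dom_open a.
have Es w : smooth_vf (coord_field a w) (dom a) by exact: smooth_coord_field.
have cs i : smooth_fun (fun=> v 0 i : R^o) (dom a) by exact: smooth_fun_cst.
rewrite -(conn_suml (index_enum 'I_n) ao ap Ya cs (fun i => Es (delta_mx 0 i))).
have sumS := smooth_vf_sum (index_enum 'I_n) ao cs (fun i => Es (delta_mx 0 i)).
apply: (conn_local nablaC ao (Es v) sumS Ya Ya _ (fun q _ => erefl) ap).
by move=> q aq; exact: coord_field_sum.
Qed.

End Connections.

Section CoordinateBracket.
Context {R : realType} {n : nat} {N : manifold R n}.

(** In the chart selected at [p], which is the one in which [lie] is computed
    at [p], coordinate fields have constant components. *)
Lemma lie_coord_field (p : N) v w :
  lie (coord_field (chart_at p) v) (coord_field (chart_at p) w) p = 0.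
Proof.
set a := chart_at p; have ap : dom a p := dom_chart_at p.
have H u t : deriv (fun q => tcoord a q (coord_field a u q)) p t = 0.
  rewrite (@deriv_eq _ _ _ _ _ (fun=> u) (dom a))//; first exact: deriv_cst.
    exact: dom_open.
  by move=> q aq; rewrite coord_fieldK.
exact: etrans (congr2 (fun x y => x - y) (H w _) (H v _)) (subrr 0).
Qed.

End CoordinateBracket.

(** * Sasakian statistical manifolds *)

Section Sasakian.
Context {R : realType} {n : nat} {N : manifold R n}.
Variable S : sasakian_statistical N.
Implicit Types (X Y : vfield N) (U : set N).
Local Notation g := (metric S).

(** The dual connection of [nabla]: since [K = nabla - lc] is totally
    symmetric, the connection dual to [lc + K] is [lc - K]. *)
Definition dual_nabla X Y : vfield N :=
  fun p => lc S X Y p - (nabla S X Y p - lc S X Y p).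

(** Add the Sasakian formula for the Levi-Civita derivative of [phi] to the
    relation [K(X, phi Y) = - phi K(X, Y)]: the sign turns [lc + K] into
    [lc - K]. *)
Lemma nabla_phi U X Y p : open U -> U p -> smooth_vf X U -> smooth_vf Y U ->
  nabla S X (fun q => phi S q (Y q)) p =
    phi S p (dual_nabla X Y p) +
    (g p (Y p) (xi S p) *: X p - g p (Y p) (X p) *: xi S p).
Proof.
move=> Uo Up XU YU; rewrite -(ss_lc_phi S Uo XU YU Up).
have /eqP := ss_K_phi S Uo XU YU Up; rewrite addr_eq0 => /eqP K.
rewrite /dual_nabla linearB /= -K.
by rewrite [X in _ = X + _]addrC -[RHS]addrA [X in _ = _ + X]addrCA subrr addr0 subrK.
Qed.

Lemma dual_nabla_coord_field (p : N) v Y :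
  smooth_vf Y (dom (chart_at p)) ->
  dual_nabla (coord_field (chart_at p) v) Y p =
    \sum_i v 0 i *: dual_nabla (coord_field (chart_at p) (delta_mx 0 i)) Y p.
Proof.
move=> Ya; have ap := dom_chart_at p; rewrite /dual_nabla.
have lcC := lc_connection (ss_levi_civita S).
have nC := stat_connection (ss_statistical S).
rewrite !(conn_coord_field lcC _ ap Ya) (conn_coord_field nC _ ap Ya) -!sumrB.
by apply: eq_bigr => i _; rewrite !scalerBr.
Qed.

(** Both [nabla] and [lc] are torsion free, and coordinate fields commute. *)
Lemma dual_nabla_coord_sym (p : N) v w :
  dual_nabla (coord_field (chart_at p) v) (coord_field (chart_at p) w) p =
  dual_nabla (coord_field (chart_at p) w) (coord_field (chart_at p) v) p.
Proof.
set a := chart_at p; have ap : dom a p := dom_chart_at p.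
have Es u : smooth_vf (coord_field a u) (dom a) by exact: smooth_coord_field.
have tf (cn : vfield N -> vfield N -> vfield N) : torsion_free cn ->
    cn (coord_field a v) (coord_field a w) p =
    cn (coord_field a w) (coord_field a v) p.
  move=> /(_ _ (dom_open a) _ _ (Es v) (Es w) _ ap).
  by rewrite lie_coord_field => /subr0_eq.
rewrite /dual_nabla (tf _ (lc_torsion_free (ss_levi_civita S))).
by rewrite (tf _ (stat_torsion_free (ss_statistical S))).
Qed.

End Sasakian.

(** * Covariant derivatives along a map *)

Section CovAlong.
Context {R : realType} {m n : nat} {M : manifold R m} {N : manifold R n}.
Variables (iota : M -> N) (S : sasakian_statistical N).
Hypothesis iotaS : smooth_map iota.
Local Notation g := (metric S).

(** Leibniz rule for [phi V], with [V] expanded on the coordinate fields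
    [E j].  The derivative along the map of a field [r |-> phi (E j r)] of the
    ambient manifold is its ambient derivative in the direction [push X]. *)
Lemma cov_along_phi (X : vfield M) (V : vfield_along (R := R) (n := n) (M := M)) p :
  let a := chart_at (iota p) in
  let E j := coord_field a (delta_mx 0 j) in
  let U := coord_field a (push iota p (X p)) in
  let c j q := tcoord a (iota q) (V q) 0 j in
  (forall j, smooth_fun (c j : M -> R^o) (iota @^-1` dom a)) ->
  cov_along iota (nabla S) X (phi_along iota S V) p =
    \sum_j ((deriv (c j : M -> R^o) p (X p) : R) *: phi S (iota p) (E j (iota p)) +
            c j p *: nabla S U (fun r => phi S r (E j r)) (iota p)).
Proof.
move=> a E U c cS; have ao := dom_open a.
have ap : dom a (iota p) := dom_chart_at (iota p).
have io := open_smooth_preimage iotaS ao.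
have nC := stat_connection (ss_statistical S).
have ES j : smooth_vf (E j) (dom a) by exact: smooth_coord_field.
have US : smooth_vf U (dom a) by exact: smooth_coord_field.
have pES j : smooth_vf (fun r => phi S r (E j r)) (dom a).
  exact: phi_smooth (ss_contact S) _ _ _ (ES j).
(* The matrix of [phi] in the frame [E]. *)
pose A j k r := tcoord a r (phi S r (E j r)) 0 k.
have AS j k : smooth_fun (A j k : N -> R^o) (dom a).
  by have := smooth_vf_coord a k ao (pES j); rewrite setIid.
have phiE j r : dom a r -> phi S r (E j r) = \sum_k A j k r *: E k r.
  by move=> ar; exact: tcoord_sum.
have Up : U (iota p) = push iota p (X p) by exact: coord_field_chart_at.
have nphiE j : nabla S U (fun r => phi S r (E j r)) (iota p) =
    \sum_k (A j k (iota p) *: nabla S U (E k) (iota p) +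
       (deriv (A j k : N -> R^o) (iota p) (push iota p (X p)) : R) *: E k (iota p)).
  rewrite -Up -(conn_sumr nC (index_enum 'I_n) ao ap US (AS j) ES).
  have sumS := smooth_vf_sum (index_enum 'I_n) ao (AS j) ES.
  exact: (conn_local nC ao US US (pES j) sumS (fun q _ => erefl) (phiE j) ap).
pose comp q := tcoord a (iota q) (phi_along iota S V q).
have compE q k : dom a (iota q) -> comp q 0 k = \sum_j c j q * A j k (iota q).
  move=> aq; rewrite /comp /phi_along [V q in LHS](tcoord_sum _ aq) linear_sum.
  have -> : \sum_i phi S (iota q) (tcoord a (iota q) (V q) 0 i *:
      coord_field a (delta_mx 0 i) (iota q)) =
      \sum_i c i q *: phi S (iota q) (E i (iota q)).
    by apply: eq_bigr => i _; rewrite linearZ.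
  by rewrite tcoord_comb// summxE; apply: eq_bigr => j _; rewrite mxE.
have cAS j k : smooth_fun (fun q => c j q * A j k (iota q) : R^o) (iota @^-1` dom a).
  exact: smooth_funM io (cS j) (smooth_comp iotaS ao (AS j k)).
have compS : smooth_fun comp (iota @^-1` dom a).
  apply/(smooth_fun_rowP _ io) => k.
  apply: (smooth_fun_eq io _ (smooth_fun_sum (index_enum 'I_n) io (cAS^~ k))).
  by move=> q aq; rewrite compE.
have dcomp k : (deriv comp p (X p)) 0 k = \sum_j (c j p *
      deriv (A j k : N -> R^o) (iota p) (push iota p (X p)) +
      A j k (iota p) * deriv (c j : M -> R^o) p (X p)) :> R.
  rewrite (deriv_row _ _ compS ap).
  rewrite (@deriv_eq _ _ _ _ _ (fun q => \sum_j c j q * A j k (iota q) : R^o)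
    (iota @^-1` dom a))//; last by move=> q aq; rewrite compE.
  rewrite (deriv_sum _ _ io (cAS^~ k) ap); apply: eq_bigr => j _.
  rewrite (deriv_mul _ (cS j) (smooth_comp iotaS ao (AS j k)) ap).
  by rewrite (deriv_push iotaS _ ao (AS j k) ap).
rewrite /cov_along -/a -/comp.
rewrite (tcoord_sum (deriv comp p (X p)) ap) tcoord_chart_at -big_split /=.
under eq_bigr => k _ do rewrite dcomp compE//.
under [RHS]eq_bigr => j _ do rewrite nphiE phiE// !scaler_sumr -big_split /=.
rewrite exchange_big /=; apply: eq_bigr => k _.
rewrite !scaler_suml -big_split /=; apply: eq_bigr => j _.
rewrite scalerDr !scalerA scalerDl [A j k _ * _]mulrC.
by rewrite -[LHS]addrA [LHS]addrC -[LHS]addrA.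
Qed.

End CovAlong.

Section Commutator.
Context {R : realType} {m n : nat} {M : manifold R m} {N : manifold R n}.
Variables (iota : M -> N) (S : sasakian_statistical N).
Hypothesis iotaS : smooth_map iota.
Local Notation g := (metric S).

(** Expand both derivatives with [cov_along_phi] and [nabla_phi].  The terms
    that differentiate the components of [X] and [Y] form the bracket, and the
    terms with [dual_nabla] of coordinate fields cancel since [dual_nabla] is
    torsion free. *)
Lemma cov_along_phi_commutator (X Y : vfield M) p :
  smooth_vf X setT -> smooth_vf Y setT ->
  cov_along iota (nabla S) X (phi_along iota S (push_vf iota Y)) p -
  cov_along iota (nabla S) Y (phi_along iota S (push_vf iota X)) p =
    phi S (iota p) (push iota p (lie X Y p)) +
    (g (iota p) (push iota p (Y p)) (xi S (iota p)) *: push iota p (X p) -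
     g (iota p) (push iota p (X p)) (xi S (iota p)) *: push iota p (Y p)).
Proof.
move=> XS YS; set a := chart_at (iota p).
have ao := dom_open a; have ap : dom a (iota p) := dom_chart_at (iota p).
have io := open_smooth_preimage iotaS ao.
pose E j := coord_field a (delta_mx 0 j).
have ES j : smooth_vf (E j) (dom a) by exact: smooth_coord_field.
pose c (Z : vfield M) j q := tcoord a (iota q) (push iota q (Z q)) 0 j.
have cS Z : smooth_vf Z setT -> forall j,
    smooth_fun (c Z j : M -> R^o) (iota @^-1` dom a).
  by move=> ZS j; have := smooth_tcoord_push iotaS a j openT ZS; rewrite setIT.
have cE Z : \sum_j c Z j p *: E j (iota p) = push iota p (Z p).
  by rewrite -(tcoord_sum (push iota p (Z p)) ap).
(* The dual derivative of [Z2] along [Z1] with the components of [Z2] treated as constants. *)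
pose cross (Z1 Z2 : vfield M) := \sum_j c Z2 j p *:
  \sum_i c Z1 i p *: dual_nabla S (E i) (E j) (iota p).
have phi2 (c1 c2 : R) v w : phi S (iota p) (c1 *: v + c2 *: w) =
    c1 *: phi S (iota p) v + c2 *: phi S (iota p) w.
  by rewrite linearD !linearZ.
have cov Z1 Z2 : smooth_vf Z1 setT -> smooth_vf Z2 setT ->
    cov_along iota (nabla S) Z1 (phi_along iota S (push_vf iota Z2)) p =
    phi S (iota p)
      (\sum_j (deriv (c Z2 j : M -> R^o) p (Z1 p) : R) *: E j (iota p) + cross Z1 Z2) +
    (g (iota p) (push iota p (Z2 p)) (xi S (iota p)) *: push iota p (Z1 p) -
     g (iota p) (push iota p (Z2 p)) (push iota p (Z1 p)) *: xi S (iota p)).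
  move=> Z1S Z2S; rewrite (cov_along_phi S iotaS Z1 (V := push_vf iota Z2) (p := p) (cS _ Z2S)) -/a.
  set U := coord_field a (push iota p (Z1 p)).
  have US : smooth_vf U (dom a) by exact: smooth_coord_field.
  have Up : U (iota p) = push iota p (Z1 p) by exact: coord_field_chart_at.
  have dE j : dual_nabla S U (E j) (iota p) =
      \sum_i c Z1 i p *: dual_nabla S (E i) (E j) (iota p).
    rewrite (dual_nabla_coord_field S (push iota p (Z1 p)) (ES j)); apply: eq_bigr => i _.
    by rewrite /c tcoord_chart_at.
  under eq_bigr => j _ do rewrite (nabla_phi S ao ap US (ES j)) Up dE.
  have gR := stat_metric (ss_statistical S).
  rewrite -(cE Z2) !(metric_suml gR) !scaler_suml -sumrB.
  rewrite /cross -big_split /= linear_sum -big_split /=.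
  apply: eq_bigr => j _; rewrite phi2 scalerDr scalerBr !scalerA.
  by rewrite [LHS]addrA.
have crossE Z1 Z2 : cross Z1 Z2 = \sum_j \sum_i
    (c Z2 j p * c Z1 i p) *: dual_nabla S (E i) (E j) (iota p).
  apply: eq_bigr => j _; rewrite scaler_sumr; apply: eq_bigr => i _.
  exact: scalerA.
have cross_sym : cross Y X = cross X Y.
  apply: etrans (crossE Y X) _; apply: etrans _ (esym (crossE X Y)).
  apply: etrans; first exact: exchange_big.
  apply: eq_bigr => j _; apply: eq_bigr => i _; rewrite mulrC.
  by rewrite /E dual_nabla_coord_sym.
have lieE : push iota p (lie X Y p) =
    \sum_j (deriv (c Y j : M -> R^o) p (X p) : R) *: E j (iota p) -
    \sum_j (deriv (c X j : M -> R^o) p (Y p) : R) *: E j (iota p).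
  rewrite (tcoord_sum (push iota p (lie X Y p)) ap) -sumrB.
  apply: eq_bigr => j _; rewrite -scalerBl; congr (_ *: _).
  exact: tcoord_push_lie iotaS _ _ _ _ _ _ openT I XS YS ap.
have gR := stat_metric (ss_statistical S).
have phiD v w : phi S (iota p) (v + w) = phi S (iota p) v + phi S (iota p) w.
  exact: linearD.
have phiB v w : phi S (iota p) (v - w) = phi S (iota p) v - phi S (iota p) w.
  exact: linearB.
have gs := metric_sym gR (iota p) (push iota p (X p)) (push iota p (Y p)).
have c1 (x y z : 'rV[R]_n) : x + z - (y + z) = x - y.
  by rewrite opprD addrACA subrr addr0.
have c2 (x y z t u w : 'rV[R]_n) :
    x + z + (t - u) - (y + z + (w - u)) = x - y + (t - w).
  rewrite opprD [LHS]addrACA; exact: congr2 (c1 _ _ _) (c1 _ _ _).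
have covXY := cov X Y XS YS; have covYX := cov Y X YS XS.
rewrite lieE phiB; clear cov lieE crossE; clearbody cross.
apply: etrans (congr2 (fun v w => v - w) covXY covYX) _ => {covXY covYX}.
rewrite cross_sym gs.
apply: etrans (congr2 (fun v w => v + _ - (w + _)) (phiD _ _) (phiD _ _)) _.
exact: c2.
Qed.

End Commutator.

(** * Contact CR-submanifolds *)

Section ContactCR.
Context {R : realType} {m n r : nat} {M : manifold R m} {N : manifold R n}.
Variables (iota : M -> N) (S : sasakian_statistical N) (D : M -> {vspace 'rV[R]_m}).
Hypothesis hCR : contact_CR iota S r D.
Local Notation g := (metric S).

(** [phi Z] is normal, hence does not see the tangential part which is removed
    in the second fundamental form. *)
Lemma metric_second_ff_phi (X : vfield M) V (Z : vfield M) p :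
  section (orthogonal_fibre iota S D) Z ->
  g (iota p) (second_ff iota S X V p) (phi_along iota S (push_vf iota Z) p) =
  g (iota p) (cov_along iota (nabla S) X V p)
    (phi S (iota p) (push iota p (Z p))).
Proof.
move=> [_ /(_ p) Zp]; have gR := stat_metric (ss_statistical S).
rewrite /second_ff /normal_part (metricBl gR) /phi_along /push_vf.
rewrite [X in _ - X](metric_sym gR).
by rewrite (cr_anti_invariant hCR Zp) subr0.
Qed.

(** Pairing with [phi Z] kills the tangent terms of the commutator, since
    [phi Z] is normal, and [eta Z = 0] because [xi] lies in [D]. *)
Lemma metric_second_ff_sub (X Y Z : vfield M) p :
  smooth_vf X setT -> smooth_vf Y setT ->
  section (orthogonal_fibre iota S D) Z ->
  g (iota p) (second_ff iota S X (phi_along iota S (push_vf iota Y)) p)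
    (phi_along iota S (push_vf iota Z) p) -
  g (iota p) (second_ff iota S Y (phi_along iota S (push_vf iota X)) p)
    (phi_along iota S (push_vf iota Z) p) =
  g (iota p) (push iota p (lie X Y p)) (push iota p (Z p)).
Proof.
move=> XS YS ZS; have gR := stat_metric (ss_statistical S).
have [_ /(_ p) Zp] := ZS.
have nZ v : g (iota p) (push iota p v) (phi S (iota p) (push iota p (Z p))) = 0.
  by rewrite (metric_sym gR); exact: cr_anti_invariant hCR _ _ Zp v.
have xiZ : eta S (iota p) (push iota p (Z p)) = 0.
  have [v Dv vxi] := cr_xi hCR p.
  by rewrite -(metric_xi (ss_contact S)) -vxi Zp.
apply: etrans (congr2 (fun v w => v - w)
  (metric_second_ff_phi _ _ _ ZS) (metric_second_ff_phi _ _ _ ZS)) _.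
rewrite -(metricBl gR).
rewrite (cov_along_phi_commutator S (cr_immersion hCR).1 p XS YS).
have tangent c1 c2 : g (iota p) (c1 *: push iota p (X p) - c2 *: push iota p (Y p))
    (phi S (iota p) (push iota p (Z p))) = 0.
  apply: etrans (metricBl gR _ _ _ _) _.
  apply: etrans (congr2 (fun a b => a - b) (metricZl gR _ _ _ _) (metricZl gR _ _ _ _)) _.
  by rewrite (nZ (X p)) (nZ (Y p)) !mulr0 subr0.
rewrite (metricDl gR) tangent addr0.
by rewrite (metric_phi (ss_contact S)) xiZ mulr0 subr0.
Qed.

End ContactCR.

(** * Orthogonal projection onto a distribution *)

Section SmoothMatrix.
Context {R : realType} {n : nat} {M : manifold R n}.
Implicit Types (U : set M) (k : nat).

Lemma smooth_det k (A : M -> 'M[R]_k) U : open U ->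
  (forall i j, smooth_fun (fun q => A q i j : R^o) U) ->
  smooth_fun (fun q => \det (A q) : R^o) U.
Proof.
move=> Uo AU; apply: smooth_fun_sum => // s; apply: smooth_funM => //.
  exact: smooth_fun_cst.
by apply: smooth_fun_prod.
Qed.

(** By Cramer's formula. *)
Lemma smooth_invmx k (A : M -> 'M[R]_k) U i j : open U ->
  (forall q, U q -> A q \in unitmx) ->
  (forall i j, smooth_fun (fun q => A q i j : R^o) U) ->
  smooth_fun (fun q => invmx (A q) i j : R^o) U.
Proof.
move=> Uo Au AU.
have adjS : smooth_fun (fun q => (\adj (A q)) i j : R^o) U.
  apply: (@smooth_fun_eq _ _ _ _ (fun q =>
    (-1) ^+ (j + i) * \det (row' j (col' i (A q))) : R^o)) => //.
    by move=> q _; rewrite !mxE.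
  apply: smooth_funM => //; first exact: smooth_fun_cst.
  apply: smooth_det => // i' j'.
  by apply: smooth_fun_eq (AU (lift j i') (lift i j')) => // q _; rewrite !mxE.
have detS : smooth_fun (fun q => (\det (A q))^-1 : R^o) U.
  apply: smooth_funV => //; last exact: smooth_det.
  by move=> q /Au; rewrite unitmxE unitfE.
apply: smooth_fun_eq (smooth_funM Uo detS adjS) => // q /Au Aq.
by rewrite /invmx Aq [RHS]mxE.
Qed.

End SmoothMatrix.

Section Projection.
Context {R : realType} {m n r : nat} {M : manifold R m} {N : manifold R n}.
Variables (iota : M -> N) (S : sasakian_statistical N) (D : M -> {vspace 'rV[R]_m}).
Hypothesis hI : immersion iota.
Local Notation g := (metric S).
Local Notation ind q v w := (g (iota q) (push iota q v) (push iota q w)).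

Let gR : riemannian_metric g := stat_metric (ss_statistical S).

(** Positive definiteness passes to the induced metric because the
    differential of an immersion is injective. *)
Lemma induced_eq0 q v : ind q v v = 0 -> v = 0.
Proof. by move=> /(metric_eq0 gR) pv; apply: (hI.2 q); rewrite pv push0//; exact: hI.1. Qed.

Lemma orthogonal_fibre_unique q w z z' :
  orthogonal_fibre iota S D q z -> orthogonal_fibre iota S D q z' ->
  w - z \in D q -> w - z' \in D q -> z = z'.
Proof.
move=> oz oz' Dz Dz'; apply/subr0_eq/(@induced_eq0 q).
have Dzz : z - z' \in D q.
  have -> : z - z' = (w - z') - (w - z) by rewrite opprB [RHS]addrC addrA subrK.
  exact: memvB.
by rewrite [X in g _ X _](pushB hI.1) (metricBl gR) (oz _ Dzz) (oz' _ Dzz) subrr.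
Qed.

Section Frame.
Variables (U : set M) (X : 'I_r -> vfield M).
Hypothesis Uo : open U.
Hypothesis XU : forall i, smooth_vf (X i) U.
Hypothesis XD : forall q, U q -> basis_of (D q) [seq X i q | i <- enum 'I_r].

Definition gram (q : M) : 'M[R]_r := \matrix_(i, j) ind q (X i q) (X j q).

Lemma frame_tuple q : U q -> exists2 t : r.-tuple 'rV[R]_m,
  basis_of (D q) t & forall i : 'I_r, t`_i = X i q.
Proof.
move=> Uq; have st : size [seq X i q | i <- enum 'I_r] == r.
  by rewrite size_map size_enum_ord.
exists (Tuple st); first exact: XD.
by move=> i; rewrite (nth_map i) ?size_enum_ord// nth_ord_enum.
Qed.

Lemma frame_free q (k : 'I_r -> R) : U q -> \sum_i k i *: X i q = 0 ->
  forall i, k i = 0.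
Proof.
move=> Uq k0; have [t /basis_free/freeP tf tX] := frame_tuple Uq.
by apply: tf; rewrite -[RHS]k0; apply: eq_bigr => i _; rewrite tX.
Qed.

Lemma frame_span q v : U q -> v \in D q -> exists k : 'I_r -> R,
  v = \sum_i k i *: X i q.
Proof.
move=> Uq vD; have [t tB tX] := frame_tuple Uq.
exists (fun i => coord t i v); rewrite [LHS](coord_basis tB vD).
by apply: eq_bigr => i _; rewrite tX.
Qed.

(** A vector in the kernel of the Gram matrix gives a combination of the frame
    that is orthogonal to the frame, hence to itself. *)
Lemma gram_unit q : U q -> gram q \in unitmx.
Proof.
move=> Uq; rewrite -row_free_unit; apply/inj_row_free => v vG.
have vX j : ind q (\sum_i v 0 i *: X i q) (X j q) = 0.
  have := congr1 (fun w : 'rV_r => w 0 j) vG; rewrite !mxE => <-.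
  rewrite (push_sum hI.1) (metric_suml gR).
  by apply: eq_bigr => i _; rewrite mxE.
have /induced_eq0/(frame_free Uq) v0 :
    ind q (\sum_i v 0 i *: X i q) (\sum_i v 0 i *: X i q) = 0.
  rewrite [X in g _ _ X](push_sum hI.1) (metric_sumr gR).
  by apply: big1 => j _; rewrite vX mulr0.
by apply/rowP => i; rewrite v0 mxE.
Qed.

(** Subtract from [W] the combination of the frame with coefficients
    [w *m invmx (gram q)], where [w] lists the products of [W] with the frame;
    Cramer's formula makes these coefficients smooth. *)
Lemma frame_projection (W : vfield M) : smooth_vf W U ->
  exists Z : vfield M, smooth_vf Z U /\ forall q, U q ->
    orthogonal_fibre iota S D q (Z q) /\ W q - Z q \in D q.
Proof.
move=> WU.
pose w (q : M) : 'rV[R]_r := \row_j ind q (W q) (X j q).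
pose c q : 'rV[R]_r := w q *m invmx (gram q).
have gS i j : smooth_fun (fun q => gram q i j : R^o) U.
  apply: (smooth_fun_eq Uo _ (smooth_induced_metric hI.1 gR Uo (XU i) (XU j))).
  by move=> q _; rewrite mxE.
have cS i : smooth_fun (fun q => - c q 0 i : R^o) U.
  apply: (@smooth_fun_eq _ _ _ _ (fun q =>
    -1 * \sum_j ind q (W q) (X j q) * invmx (gram q) j i : R^o)) => //.
    by move=> q _; rewrite mxE mulN1r; congr (- _); apply: eq_bigr => j _; rewrite mxE.
  apply: smooth_funM => //; first exact: smooth_fun_cst.
  apply: smooth_fun_sum => // j; apply: smooth_funM => //.
    exact (smooth_induced_metric hI.1 gR Uo WU (XU j)).
  exact: smooth_invmx Uo gram_unit gS.
exists (fun q => 1 *: W q + \sum_i (- c q 0 i) *: X i q); split.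
  have sumS := smooth_vf_sum (index_enum 'I_r) Uo cS XU.
  exact: (smooth_vf_comb Uo (smooth_fun_cst (1 : R^o) U) WU sumS).
move=> q Uq; split; last first.
  rewrite scale1r opprD addNKr; apply: rpredNr; apply: rpred_sum => i _.
  rewrite memvZ//; have [t tB tX] := frame_tuple Uq.
  by rewrite -tX; apply: (basis_mem tB); rewrite mem_nth// size_tuple.
move=> v /(frame_span Uq)[k ->].
rewrite [X in g _ _ X](push_sum hI.1) (metric_sumr gR); apply: big1 => j _.
rewrite (push_linear hI.1) (metric_linear_l gR) mul1r (push_sum hI.1) (metric_suml gR).
have -> : \sum_i - c q 0 i * ind q (X i q) (X j q) = - (c q *m gram q) 0 j.
  by rewrite mxE -sumrN; apply: eq_bigr => i _; rewrite [gram q i j]mxE mulNr.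
by rewrite mulmxKV ?gram_unit// mxE subrr mulr0.
Qed.

End Frame.

(** The orthogonal component is unique, so the local ones agree on
    overlaps and the pointwise choice is smooth. *)
Lemma smooth_orthogonal_part (W : vfield M) :
  distribution r D -> smooth_vf W setT ->
  exists2 Z : vfield M, section (orthogonal_fibre iota S D) Z &
    forall q, W q - Z q \in D q.
Proof.
move=> hD WS.
pose P q z := orthogonal_fibre iota S D q z /\ W q - z \in D q.
have loc p : exists A : set M, [/\ open A, A p &
    exists2 Z : vfield M, smooth_vf Z A & forall q, A q -> P q (Z q)].
  have [U [Uo Up [X [XU XD]]]] := hD p.
  have WU : smooth_vf W U by apply: smooth_vf_sub WS.
  by have [Z [ZU ZP]] := frame_projection Uo XU XD WU; exists U; split=> //; exists Z.
pose Z q := xget 0 (P q).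
have ZP q : P q (Z q).
  have [A [_ Aq [Z' _ Z'P]]] := loc q.
  exact: xgetPex (ex_intro _ _ (Z'P _ Aq)).
exists Z; last by move=> q; exact: (ZP q).2.
split; last by move=> q; exact: (ZP q).1.
apply: smooth_vf_local => p _; have [A [Ao Ap [Z' Z'S Z'P]]] := loc p.
exists A; first exact: Ap.
apply: (smooth_vf_eq Ao _ Z'S) => q Aq.
have [oZ' DZ'] := Z'P _ Aq; have [oZ DZ] := ZP q.
exact: orthogonal_fibre_unique oZ' oZ DZ' DZ.
Qed.

End Projection.

Theorem theorem3p5 (R : realType) (m n r : nat)
    (Mbar : manifold R n) (S : sasakian_statistical Mbar)
    (M : manifold R m) (iota : M -> Mbar) (D : M -> {vspace 'rV[R]_m})
    (hCR : contact_CR iota S r D) :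
  integrable_distribution D <->
  (forall X Y Z : vfield M,
     section (fibre D) X -> section (fibre D) Y ->
     section (orthogonal_fibre iota S D) Z ->
     forall p : M,
       metric S (iota p)
         (second_ff iota S X (phi_along iota S (push_vf iota Y)) p)
         (phi_along iota S (push_vf iota Z) p) =
       metric S (iota p)
         (second_ff iota S Y (phi_along iota S (push_vf iota X)) p)
         (phi_along iota S (push_vf iota Z) p)).
Proof.
have gR := stat_metric (ss_statistical S).
split=> [Dint X Y Z XD YD ZD p|Dsym X Y XD YD].
  apply/subr0_eq; apply: etrans (metric_second_ff_sub hCR _ XD.1 YD.1 ZD) _.
  by rewrite (metric_sym gR); apply: (ZD.2 p); exact: (Dint X Y XD YD).2.
have lieS := smooth_lie openT XD.1 YD.1.
have [Z ZD lieZ] := smooth_orthogonal_part S (cr_immersion hCR) (cr_distribution hCR) lieS.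
split=> // p; suff Z0 : Z p = 0 by have := lieZ p; rewrite Z0 subr0.
apply: (@induced_eq0 _ _ _ _ _ iota S (cr_immersion hCR) p).
have lie_orth : metric S (iota p) (push iota p (lie X Y p)) (push iota p (Z p)) = 0.
  apply: etrans (esym (metric_second_ff_sub hCR p XD.1 YD.1 ZD)) _.
  by apply/eqP; rewrite subr_eq0; apply/eqP; exact: Dsym.
have D_orth : metric S (iota p) (push iota p (lie X Y p - Z p)) (push iota p (Z p)) = 0.
  by rewrite (metric_sym gR); exact: (ZD.2 p _ (lieZ p)).
have ZE : push iota p (Z p) = push iota p (lie X Y p) - push iota p (lie X Y p - Z p).
  by rewrite -(pushB (cr_immersion hCR).1) opprB addrCA subrr addr0.
rewrite [X in metric _ _ X _]ZE (metricBl gR) lie_orth D_orth.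
exact: subrr.
Qed.
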